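(* Let $L$ be a graph with radius two. Then there exists $n$ such that $\mathrm{Tr}(n)\to L$ if and only if $L$ is a subgraph of a jellyfish $J_k$ or of a bistar $B_k$ for some positive integer $k$.
   Context: For graphs $G$ and $H$, write $G\to H$ if every 2-edge-coloring of $G$ contains a monochromatic copy of $H$ (a subgraph isomorphic to $H$ all of whose edges have the same color). The iterated triangulation $\mathrm{Tr}(n)$ is the plane graph defined recursively: $\mathrm{Tr}(0)\cong K_3$ is the plane triangle; for $i\ge 0$, $\mathrm{Tr}(i+1)$ is obtained from $\mathrm{Tr}(i)$ by placing a new vertex inside each inner face of $\mathrm{Tr}(i)$ and joining it by edges to the three vertices on the boundary of that face. A flower $F_k$ is a collection of $k$ copies of $C_4$ sharing exactly one common vertex, called the center. A jellyfish $J_k$ is obtained from $F_k$ and a $k$-ary tree of radius two (rooted tree whose root has $k$ children, each of which has $k$ children) by identifying the center of $F_k$ with the root of the tree. A bistar $B_k$ is obtained from one $C_4$ and two disjoint stars $K_{1,k}$ by identifying the centers (roots) of the two stars with the two vertices of a pair of non-adjacent vertices of the $C_4$, respectively. *)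

(* Defs.v *)
From mathcomp Require Import all_boot.

Set Implicit Arguments.
Unset Strict Implicit.
Unset Printing Implicit Defensive.

Record sgraph := SGraph {
  vertex :> finType;
  adj : rel vertex;
  adj_sym : symmetric adj;
  adj_irr : irreflexive adj
}.

(* No vertex of a disconnected graph has an eccentricity, so such a graph has
   no radius in the sense of [is_radius]. *)
Definition has_walk (G : sgraph) (x y : G) (d : nat) : Prop :=
  exists p : seq G, [/\ path (@adj G) x p, last x p = y & size p = d].

Definition is_dist (G : sgraph) (x y : G) (d : nat) : Prop :=
  has_walk x y d /\ (forall d', has_walk x y d' -> d <= d').

Definition is_ecc (G : sgraph) (x : G) (e : nat) : Prop :=
  (forall y, exists2 d, is_dist x y d & d <= e) /\ (exists y, is_dist x y e).

Definition is_radius (G : sgraph) (r : nat) : Prop :=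
  (exists x : G, is_ecc x r) /\ (forall (x : G) e, is_ecc x e -> r <= e).

Definition is_copy (H G : sgraph) (f : H -> G) : Prop :=
  injective f /\ (forall u v, adj u v -> adj (f u) (f v)).

Definition subgraph_of (H G : sgraph) : Prop :=
  exists f : H -> G, is_copy f.

(* A 2-edge-coloring is given by a function on all vertex sets; only its values
   on the edges [set x; y] with adj x y are ever used. *)
Definition arrows (G H : sgraph) : Prop :=
  forall c : {set G} -> bool,
    exists (f : H -> G) (b : bool),
      is_copy f /\ (forall u v, adj u v -> c [set f u; f v] = b).

(* The part of a plane graph with triangular inner faces that the construction
   of Tr needs: the graph, the inner faces, and the three vertices on the
   boundary of each inner face (in an arbitrary order). *)
Record face_graph := FaceGraph {
  fgraph :> sgraph;
  face : finType;
  boundary : face -> 'I_3 -> fgraph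
}.

Definition triangle_adj : rel 'I_3 := fun i j => i != j.

Lemma triangle_sym : symmetric triangle_adj.
Proof. by move=> i j; rewrite /triangle_adj eq_sym. Qed.

Lemma triangle_irr : irreflexive triangle_adj.
Proof. by move=> i; rewrite /triangle_adj eqxx. Qed.

Definition triangle : sgraph := SGraph triangle_sym triangle_irr.

Definition Tr0 : face_graph :=
  @FaceGraph triangle unit (fun _ i => i).

Section Stack.
Variable P : face_graph.

Definition stack_adj : rel (P + face P)%type := fun x y =>
  match x, y with
  | inl u, inl v => adj u v
  | inl u, inr f => [exists i, boundary f i == u]
  | inr f, inl u => [exists i, boundary f i == u]
  | inr _, inr _ => false
  end.

Lemma stack_sym : symmetric stack_adj.
Proof. by case=> [u|f] [v|g] //=; rewrite adj_sym. Qed.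

Lemma stack_irr : irreflexive stack_adj.
Proof. by case=> [u|f] //=; rewrite adj_irr. Qed.

(* The vertex [inr f] is placed inside f and splits f into three inner faces;
   the face (f, i) has the boundary of f with its i-th vertex replaced by
   [inr f]. *)
Definition stack : face_graph :=
  @FaceGraph (SGraph stack_sym stack_irr) (face P * 'I_3)%type
    (fun fi j => if j == fi.2 then inr fi.1 else inl (boundary fi.1 j)).

End Stack.

Definition Tr (n : nat) : face_graph := iter n stack Tr0.

Section Glue.
Variables (G : sgraph) (x : G) (H : sgraph) (y : H).

Definition glue_adj : rel (G + {z : H | z != y})%type := fun a b =>
  match a, b with
  | inl u, inl v => adj u v
  | inl u, inr w => (u == x) && adj y (val w)
  | inr w, inl u => (u == x) && adj y (val w)
  | inr w, inr z => adj (val w) (val z)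
  end.

Lemma glue_sym : symmetric glue_adj.
Proof. by case=> [u|w] [v|z] //=; rewrite adj_sym. Qed.

Lemma glue_irr : irreflexive glue_adj.
Proof. by case=> [u|w] /=; rewrite adj_irr. Qed.

(* The disjoint union of G and H with y identified with x. *)
Definition glue : sgraph := SGraph glue_sym glue_irr.

End Glue.

Definition C4_adj : rel 'I_4 := fun i j =>
  (i.+1 %% 4 == j) || (j.+1 %% 4 == i).

Lemma C4_sym : symmetric C4_adj.
Proof. by move=> i j; rewrite /C4_adj orbC. Qed.

Lemma C4_irr : irreflexive C4_adj.
Proof. by case=> [[|[|[|[|i]]]] lt_i4]. Qed.

Definition C4 : sgraph := SGraph C4_sym C4_irr.

Definition star_adj (k : nat) : rel (option 'I_k) := fun a b =>
  (a == None) != (b == None).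

Lemma star_sym k : symmetric (@star_adj k).
Proof. by move=> a b; rewrite /star_adj eq_sym. Qed.

Lemma star_irr k : irreflexive (@star_adj k).
Proof. by move=> a; rewrite /star_adj eqxx. Qed.

Definition star (k : nat) : sgraph := SGraph (@star_sym k) (@star_irr k).

(* The root is None, its i-th child is Some (i, None), and the j-th child of
   the latter is Some (i, Some j). *)
Definition tree2_adj (k : nat) : rel (option ('I_k * option 'I_k)) :=
  fun a b =>
  match a, b with
  | None, Some (_, None) => true
  | Some (_, None), None => true
  | Some (i, None), Some (i', Some _) => i == i'
  | Some (i, Some _), Some (i', None) => i == i'
  | _, _ => false
  end.

Lemma tree2_sym k : symmetric (@tree2_adj k).
Proof. by case=> [[i [j|]]|] [[i' [j'|]]|] //=; rewrite eq_sym. Qed.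

Lemma tree2_irr k : irreflexive (@tree2_adj k).
Proof. by case=> [[i [j|]]|]. Qed.

Definition tree2 (k : nat) : sgraph := SGraph (@tree2_sym k) (@tree2_irr k).

(* The center None is the vertex 0 of every copy of C4, and Some (i, a) is the
   vertex a.+1 of the i-th copy. *)
Definition flower_adj (k : nat) : rel (option ('I_k * 'I_3)) := fun a b =>
  match a, b with
  | None, None => false
  | None, Some (_, v) => C4_adj ord0 (lift ord0 v)
  | Some (_, u), None => C4_adj (lift ord0 u) ord0
  | Some (i, u), Some (j, v) =>
      (i == j) && C4_adj (lift ord0 u) (lift ord0 v)
  end.

Lemma flower_sym k : symmetric (@flower_adj k).
Proof.
by case=> [[i u]|] [[j v]|] //=; rewrite C4_sym // eq_sym.
Qed.

Lemma flower_irr k : irreflexive (@flower_adj k).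
Proof. by case=> [[i u]|] //=; rewrite C4_irr andbF. Qed.

Definition flower (k : nat) : sgraph := SGraph (@flower_sym k) (@flower_irr k).

Definition jellyfish (k : nat) : sgraph :=
  @glue (flower k) None (tree2 k) None.

Definition bistar (k : nat) : sgraph :=
  @glue (@glue C4 (inord 0) (star k) None) (inl (inord 2)) (star k) None.

(* Main.v *)
Require Import Defs.
From mathcomp Require Import all_boot.
From mathcomp Require Import fingroup perm.
From Stdlib Require Import Classical ClassicalEpsilon.

(** Upper bound. By compactness it suffices to color the union of all [Tr n],
    every triangle of which again bounds a copy of the whole. If some vertex [v]
    has all its edges inside some triangle of one color [r], then either [v] lies
    on infinitely many disjoint [r]-colored 4-cycles and has infinitely many
    [r]-neighbors of infinite [r]-degree, or the other color is so dense on the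
    neighbors of [v] that it contains everything. Otherwise every vertex has
    infinite degree in both colors inside every triangle, and only the 4-cycles
    are missing. A finite search shows that every coloring has a monochromatic
    4-cycle through one of two given corners [u], [v] of the outer triangle.
    Hence either [u] lies on such a 4-cycle in every triangle at [u], or in some
    triangle no such 4-cycle meets [u], and then shrinking this triangle along an
    edge [uv] yields infinitely many disjoint ones through [v].

    Lower bound. Three colorings of [Tr n] avoid, respectively, odd cycles,
    K_{2,3}, and the 4-cycle with pendant edges at two adjacent vertices; a graph
    of radius two that contains none of these is a subgraph of a jellyfish or of
    a bistar. *)

Set Implicit Arguments.
Unset Strict Implicit.
Unset Printing Implicit Defensive.

(** * The infinite iterated triangulation *)

Local Notation o0 := (Ordinal (isT : 0 < 3)).
Local Notation o1 := (Ordinal (isT : 1 < 3)).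
Local Notation o2 := (Ordinal (isT : 2 < 3)).

(* A word [s] is the address of a face: its letters say which boundary vertex is
   replaced at each step. The vertex [inr s] is the one placed inside the face
   [s], and [inl i] is a corner of the outer triangle. *)
Local Notation V := ('I_3 + seq 'I_3)%type.

(** Copies the whole triangulation into the [i]-th subface of the outer face: the corner [i] moves
    to the centre [inr [::]], the other two stay. Iterating along [s], [shift s] copies it into the
    face [s]. *)
Definition sub_face (i : 'I_3) (x : V) : V :=
  match x with
  | inl j => if j == i then inr [::] else inl j
  | inr s => inr (i :: s)
  end.

Fixpoint shift (s : seq 'I_3) (x : V) : V :=
  if s is i :: s' then sub_face i (shift s' x) else x.

Definition bd (s : seq 'I_3) (j : 'I_3) : V := shift s (inl j).

Definition below (x y : V) : bool :=
  if x is inr s then y \in [:: bd s o0; bd s o1; bd s o2] else false.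

Definition vadj (x y : V) : bool :=
  match x, y with
  | inl i, inl j => i != j
  | _, _ => below x y || below y x
  end.

(** The stage at which a vertex appears: [Tr n] consists of the vertices with [ht x <= n]. *)
Definition ht (x : V) : nat := if x is inr s then (size s).+1 else 0.

Lemma ord3P (P : 'I_3 -> Prop) : P o0 -> P o1 -> P o2 -> forall i, P i.
Proof.
move=> P0 P1 P2 [[|[|[|n]]] lt_n3] //.
- by rewrite (_ : Ordinal _ = o0) //; apply: val_inj.
- by rewrite (_ : Ordinal _ = o1) //; apply: val_inj.
- by rewrite (_ : Ordinal _ = o2) //; apply: val_inj.
Qed.

Lemma belowP x y : reflect (exists s j, x = inr s /\ y = bd s j) (below x y).
Proof.
apply: (iffP idP) => [|[s [j [-> ->]]]].
  case: x => [//|s]; rewrite /= !inE => /or3P[] /eqP ->;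
    by exists s; eexists.
by move: j; apply: ord3P; rewrite /= !inE eqxx ?orbT.
Qed.

Lemma ht_sub_face i x : ht (sub_face i x) <= (ht x).+1.
Proof. by case: x => [j|s] //=; case: ifP. Qed.

Lemma ht_bd s j : ht (bd s j) <= size s.
Proof.
elim: s => [//|i s IHs].
by apply: leq_trans (ht_sub_face _ _) _; rewrite ltnS.
Qed.

Lemma bd_rcons s i j : bd (rcons s i) j = if j == i then inr s else bd s j.
Proof.
elim: s => [|k s IHs] /=; first by rewrite /bd /=; case: ifP.
by rewrite /bd /= -!/(bd _ _) IHs; case: ifP.
Qed.

Lemma vadj_sym : symmetric vadj.
Proof. by case=> [i|s] [j|t]; rewrite /vadj 1?orbC // eq_sym. Qed.

Lemma vadj_below x y : below x y -> vadj x y.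
Proof. by case: x => [//|s] Hxy; rewrite /vadj Hxy. Qed.

Lemma vadj_bd s j : vadj (inr s) (bd s j).
Proof. by apply: vadj_below; apply/belowP; exists s, j. Qed.

Lemma vadjP x y : vadj x y ->
  [\/ exists i j, [/\ x = inl i, y = inl j & i != j],
      exists s j, x = inr s /\ y = bd s j
    | exists s j, y = inr s /\ x = bd s j].
Proof.
case: x => [i|s]; case: y => [j|t]; first by move=> ij; constructor 1; exists i, j.
all: by case/orP=> /belowP H; [constructor 2|constructor 3].
Qed.

Lemma vadj_irr x : vadj x x = false.
Proof.
apply/negP => /vadjP[[i [j [-> [<-]]]]|[s [j [-> E]]]|[s [j [-> E]]]].
- by rewrite eqxx.
- by have := ht_bd s j; rewrite -E ltnn.
- by have := ht_bd s j; rewrite -E ltnn.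
Qed.

Lemma vadj_neq x y : vadj x y -> x != y.
Proof. by apply: contraTneq => ->; rewrite vadj_irr. Qed.

(** Self-embeddings of the triangulation: a monochromatic copy found after pulling a coloring back
    along a chart is one for the coloring itself. *)
Definition chart (e : V -> V) : Prop :=
  injective e /\ (forall x y, vadj x y -> vadj (e x) (e y)).

Lemma chart_id : chart id.
Proof. by split=> [x y|x y]. Qed.

Lemma chart_comp e e' : chart e -> chart e' -> chart (e \o e').
Proof.
move=> [inj_e adj_e] [inj_e' adj_e']; split; first exact: inj_comp.
by move=> x y /adj_e' /adj_e.
Qed.

Lemma chart_iter n e : chart e -> chart (iter n e).
Proof.
by move=> He; elim: n => [|n IHn]; [exact: chart_id|apply: chart_comp He IHn].
Qed.

Lemma sub_face_inj i : injective (sub_face i).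
Proof.
case=> [j|s] [k|t] //=; try by case: ifP.
  by case: eqP => [->|_]; case: eqP => [->|_] // [->].
by case=> ->.
Qed.

Lemma chart_sub_face i : chart (sub_face i).
Proof.
split=> [|x y]; first exact: sub_face_inj.
have H s j : vadj (sub_face i (inr s)) (sub_face i (bd s j)).
  exact: (vadj_bd (i :: s) j).
case/vadjP=> [[j [k [-> -> jk]]]|[s [j [-> ->]]]|[s [j [-> ->]]]] //;
  last by rewrite vadj_sym.
rewrite /=; case: eqP => [ji|_]; case: eqP => [ki|_] //.
- by rewrite ji ki eqxx in jk.
- exact: (vadj_bd [::] k).
- by rewrite vadj_sym; apply: (vadj_bd [::] j).
Qed.

Lemma chart_shift s : chart (shift s).
Proof.
elim: s => [|i s IHs]; first exact: chart_id.
exact: chart_comp (chart_sub_face i) IHs.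
Qed.

Lemma shift_inr s t : shift s (inr t) = inr (s ++ t).
Proof. by elim: s => //= i s ->. Qed.

Definition perm_face (p : {perm 'I_3}) (x : V) : V :=
  match x with inl j => inl (p j) | inr s => inr (map p s) end.

Lemma perm_face_bd p s j : perm_face p (bd s j) = bd (map p s) (p j).
Proof.
have H i x : perm_face p (sub_face i x) = sub_face (p i) (perm_face p x).
  by case: x => [k|t] //=; rewrite (inj_eq perm_inj); case: ifP.
by elim: s => [//|i s IHs]; rewrite /bd /= H -!/(bd _ _) IHs.
Qed.

Lemma chart_perm_face p : chart (perm_face p).
Proof.
split=> [[j|s] [k|t] //= [] E|x y].
- by rewrite (perm_inj E).
- by rewrite (inj_map perm_inj E).
case/vadjP=> [[j [k [-> -> jk]]]|[s [j [-> ->]]]|[s [j [-> ->]]]].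
- by rewrite /= (inj_eq perm_inj).
- by rewrite perm_face_bd; apply: vadj_bd.
- by rewrite perm_face_bd vadj_sym; apply: vadj_bd.
Qed.

Lemma perm_pair (i j : 'I_3) : i != j -> exists p : {perm 'I_3}, p o0 = i /\ p o1 = j.
Proof.
(* [k] is the preimage of [j] under the transposition of [o0] and [i]; moving [o1] to [k] first
   leaves [o0] fixed. *)
move=> ij; pose k := tperm o0 i j.
have k0 : k != o0.
  by rewrite /k -[X in _ != X](tpermR o0 i) (inj_eq perm_inj) eq_sym.
exists (tperm o1 k * tperm o0 i)%g; rewrite !permM; split.
  by rewrite (@tpermD _ o1 k o0) ?tpermL //.
by rewrite tpermL /k tpermK.
Qed.

(** An edge from the centre of a face [s] to its corner [j] is a side of the subface of [s] that
    replaces a corner [i != j], and a permutation of the corners orients it. So any edge may be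
    treated as the outer edge [v0 v1]. *)
Lemma chart_edge x y : vadj x y ->
  exists e, [/\ chart e, e (inl o0) = x & e (inl o1) = y].
Proof.
have ex_other (j : 'I_3) : exists i, i != j.
  by move: j; apply: ord3P; [exists o1|exists o0|exists o0].
have centre s i j : i != j ->
    [/\ chart (shift s \o sub_face i), (shift s \o sub_face i) (inl i) = inr s
      & (shift s \o sub_face i) (inl j) = bd s j].
  move=> ij; split; first exact: chart_comp (chart_shift s) (chart_sub_face i).
    by rewrite /= eqxx shift_inr cats0.
  by rewrite /comp /sub_face ifN // eq_sym.
case/vadjP=> [[i [j [-> -> ij]]]|[s [j [-> ->]]]|[s [j [-> ->]]]].
- have [p [<- <-]] := perm_pair ij.
  by exists (perm_face p); split=> //; exact: chart_perm_face.
- have [i ij] := ex_other j; have [He Ei Ej] := centre s i j ij.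
  have [p [pi pj]] := perm_pair ij; exists (shift s \o sub_face i \o perm_face p).
  split; first exact: chart_comp He (chart_perm_face p).
    by rewrite -Ei -pi.
  by rewrite -Ej -pj.
- have [i ij] := ex_other j; have [He Ei Ej] := centre s i j ij.
  rewrite eq_sym in ij; have [p [pj pi]] := perm_pair ij.
  exists (shift s \o sub_face i \o perm_face p).
  split; first exact: chart_comp He (chart_perm_face p).
    by rewrite -Ej -pj.
  by rewrite -Ei -pi.
Qed.

(** * Finite stages of the infinite triangulation *)

Fixpoint tr_face (n : nat) (s : seq 'I_3) : face (Tr n) :=
  if n is n'.+1 return face (Tr n)
  then (tr_face n' (take n' s), nth o0 s n') else tt.

(** The value is meaningful for [ht x <= n]; higher vertices fall through to the default [o0]. *)
Fixpoint tr_vertex (n : nat) (x : V) : Tr n :=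
  if n is n'.+1 return Tr n then
    if x is inr s then
      if size s == n' then inr (tr_face n' s) else inl (tr_vertex n' x)
    else inl (tr_vertex n' x)
  else if x is inl i then i else o0.

Lemma tr_face_rcons n s i : size s = n ->
  tr_face n.+1 (rcons s i) = (tr_face n s, i).
Proof. by move=> /= <-; rewrite nth_rcons ltnn eqxx -cats1 take_size_cat. Qed.

Lemma tr_vertex_inr n s : size s = n ->
  tr_vertex n.+1 (inr s) = inr (tr_face n s).
Proof. by move=> /= ->; rewrite eqxx. Qed.

Lemma tr_vertex_inl n x : ht x <= n -> tr_vertex n.+1 x = inl (tr_vertex n x).
Proof. by case: x => [//|s] /=; case: eqP => // ->; rewrite ltnn. Qed.

Lemma boundary_tr_face n s j : size s = n ->
  boundary (tr_face n s) j = tr_vertex n (bd s j).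
Proof.
elim: n s => [|n IHn] s; first by move/size0nil=> ->.
case/lastP: s => [//|s i]; rewrite size_rcons => -[sz_s].
rewrite (tr_face_rcons _ sz_s) bd_rcons [LHS]/=.
case: ifP => _; first by rewrite tr_vertex_inr.
by rewrite (IHn _ sz_s) tr_vertex_inl // -sz_s ht_bd.
Qed.

Lemma tr_face_inj n s t : size s = n -> size t = n ->
  tr_face n s = tr_face n t -> s = t.
Proof.
elim: n s t => [|n IHn] s t; first by move=> /size0nil-> /size0nil->.
case/lastP: s => [//|s i]; rewrite size_rcons => -[sz_s].
case/lastP: t => [//|t j]; rewrite size_rcons => -[sz_t].
rewrite (tr_face_rcons _ sz_s) (tr_face_rcons _ sz_t) => -[/(IHn _ _ sz_s sz_t)].
by move=> -> ->.
Qed.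

Lemma tr_vertex_inj n x y : ht x <= n -> ht y <= n ->
  tr_vertex n x = tr_vertex n y -> x = y.
Proof.
elim: n x y => [|n IHn] x y; first by case: x y => [i|s] [j|t] // _ _ /= ->.
have caseP z : ht z <= n.+1 -> (exists2 s, z = inr s & size s = n) \/ ht z <= n.
  rewrite leq_eqVlt ltnS => /predU1P[E|]; last by right.
  by left; case: z E => [//|s] [sz_s]; exists s.
case/caseP=> [[s -> sz_s]|le_x]; case/caseP=> [[t -> sz_t]|le_y].
- by rewrite !tr_vertex_inr // => -[/(tr_face_inj sz_s sz_t) ->].
- by rewrite tr_vertex_inr // tr_vertex_inl.
- by rewrite tr_vertex_inl // tr_vertex_inr.
- by rewrite !tr_vertex_inl // => -[]; exact: IHn.
Qed.

Lemma tr_vertex_adj n x y : ht x <= n -> ht y <= n -> vadj x y ->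
  adj (tr_vertex n x) (tr_vertex n y).
Proof.
move=> le_x le_y.
suff bd_adj s j : size s < n -> adj (tr_vertex n (inr s)) (tr_vertex n (bd s j)).
  case/vadjP=> [[i [j [-> -> ij]]]|[s [j [Ex Ey]]]|[s [j [Ey Ex]]]].
  - by elim: n {le_x le_y bd_adj} => [//|n IHn].
  - by rewrite Ex Ey; apply: bd_adj; rewrite Ex in le_x.
  - by rewrite Ex Ey adj_sym; apply: bd_adj; rewrite Ey in le_y.
elim: n {x y le_x le_y} => [//|n IHn]; rewrite ltnS leq_eqVlt.
have le_bd := ht_bd s j.
case/predU1P=> [sz_s|lt_s].
  rewrite tr_vertex_inr // tr_vertex_inl -?sz_s //=.
  by apply/existsP; exists j; rewrite sz_s boundary_tr_face.
rewrite !tr_vertex_inl //; first exact: IHn.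
exact: leq_trans le_bd (ltnW lt_s).
Qed.

(** * Colorings of the infinite triangulation and compactness *)

Definition coloring := V -> V -> bool.

Definition pull (c : coloring) (e : V -> V) : coloring := fun x y => c (e x) (e y).

Definition mono_copy (c : coloring) (H : sgraph) (f : H -> V) (r : bool) : Prop :=
  injective f /\ (forall x y, adj x y -> vadj (f x) (f y) /\ c (f x) (f y) = r).

Definition has_mono (c : coloring) (H : sgraph) : Prop :=
  exists (f : H -> V) (r : bool), mono_copy c f r.

Lemma has_mono_pull c e H : chart e -> has_mono (pull c e) H -> has_mono c H.
Proof.
move=> [inj_e adj_e] [f [r [inj_f mono_f]]]; exists (e \o f), r.
split=> [|x y /mono_f[/adj_e]] //; exact: inj_comp.
Qed.

(* Konig's lemma: the limit is read off a branch of the binary tree of those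
   finite prefixes that infinitely many of the sequences share. *)
Lemma bool_seq_limit (u : nat -> nat -> bool) :
  exists v : nat -> bool, forall m, exists2 n, m <= n & forall k, k < m -> u n k = v k.
Proof.
pose P (t : seq bool) := forall m, exists2 n, m <= n & t = mkseq (u n) (size t).
have extP t : P t -> P (rcons t true) \/ P (rcons t false).
  move=> Pt; apply: NNPP => /not_or_and[/not_all_ex_not[m1 H1] /not_all_ex_not[m2 H2]].
  have [n le_n Et] := Pt (maxn m1 m2).
  have E b : u n (size t) = b -> rcons t b = mkseq (u n) (size (rcons t b)).
    by move=> <-; rewrite size_rcons mkseqS -Et.
  case ub: (u n (size t)).
    by apply: H1; exists n; [exact: leq_trans (leq_maxl _ _) le_n|exact: E].
  by apply: H2; exists n; [exact: leq_trans (leq_maxr _ _) le_n|exact: E].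
pose next t := rcons t (if excluded_middle_informative (P (rcons t true)) then true
                        else false).
pose t m := iter m next [::].
have Pt m : P (t m).
  elim: m => [|m IHm] /=; first by move=> m; exists m.
  by rewrite /next; case: excluded_middle_informative => // nP; case: (extP _ IHm).
have sz_t m : size (t m) = m by elim: m => //= m IHm; rewrite size_rcons IHm.
have nth_t m k : k < m -> nth false (t m) k = nth false (t k.+1) k.
  elim: m => // m IHm; rewrite ltnS leq_eqVlt => /predU1P[-> //|lt_k].
  by rewrite [t m.+1]/= nth_rcons sz_t lt_k IHm.
exists (fun k => nth false (t k.+1) k) => m.
have [n le_n Et] := Pt m m; exists n => // k lt_k.
by rewrite -(nth_t _ _ lt_k) Et sz_t nth_mkseq.
Qed.

(** If every [Tr n] had a bad coloring, a limit of these would agree with bad colorings for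
    arbitrarily large [n] on any finite set of pairs. A monochromatic copy in the limit is finite,
    so it would already occur in one of them. *)
Lemma compactness (H : sgraph) :
  (forall c : coloring, (forall x y, c x y = c y x) -> has_mono c H) ->
  exists n, arrows (Tr n) H.
Proof.
move=> Hc; apply: NNPP => no_n.
have bad n : {C : {set Tr n} -> bool | ~ exists (f : H -> Tr n) (b : bool),
    is_copy f /\ (forall u v, adj u v -> C [set f u; f v] = b)}.
  apply: constructive_indefinite_description; apply: not_all_ex_not => Hn.
  by apply: no_n; exists n.
pose C n := sval (bad n); have badC n := svalP (bad n).
pose col n x y := C n [set tr_vertex n x; tr_vertex n y].
pose u n k := if @unpickle (V * V)%type k is Some p then col n p.1 p.2 else false.
have [v vP] := bool_seq_limit u.
pose c (x y : V) := v (pickle (x, y)).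
have cP m : exists2 n, m <= n &
    forall x y : V, pickle (x, y) < m -> c x y = col n x y.
  have [n le_n agree] := vP m; exists n => // x y /agree.
  by rewrite /u pickleK /c => <-.
have c_sym x y : c x y = c y x.
  have [n _ agree] := cP (maxn (pickle (x, y)) (pickle (y, x))).+1.
  by rewrite !agree ?ltnS ?leq_maxl ?leq_maxr // /col setUC.
have [f [r [inj_f mono_f]]] := Hc c c_sym.
(* [m] exceeds the code of every pair in the copy and bounds the heights of its vertices, so stage
   [n >= m] contains the copy and colors it as [c] does. *)
pose m := \max_(p : H * H) (maxn (pickle (f p.1, f p.2)).+1 (ht (f p.1))).
have [n le_n agree] := cP m.
have le_ht a : ht (f a) <= n.
  apply: leq_trans le_n; apply: leq_trans (leq_bigmax (a, a)).
  exact: leq_maxr.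
apply: (badC n); exists (tr_vertex n \o f), r; split; first split.
- by move=> a b /tr_vertex_inj E; apply: inj_f; apply: E.
- by move=> a b /mono_f[] ab _; apply: tr_vertex_adj.
- move=> a b /mono_f[] _ <-; rewrite agree //.
  by apply: leq_trans (leq_bigmax (a, b)); exact: leq_maxl.
Qed.

(** * Jellyfish and bistars from infinite degrees *)

Definition sym_col (c : coloring) : Prop := forall x y, c x y = c y x.

Lemma sym_pull c e : sym_col c -> sym_col (pull c e).
Proof. by move=> c_sym x y; exact: c_sym. Qed.

Definition edge_in (c : coloring) (r : bool) (x y : V) : bool :=
  vadj x y && (c x y == r).

Lemma edge_in_sym c r x y : sym_col c -> edge_in c r x y = edge_in c r y x.
Proof. by move=> c_sym; rewrite /edge_in vadj_sym c_sym. Qed.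

Definition C4_in (c : coloring) (r : bool) (x a y b : V) : bool :=
  [&& uniq [:: x; a; y; b], edge_in c r x a, edge_in c r a y, edge_in c r y b
    & edge_in c r b x].

Lemma C4_in_rot c r x a y b : C4_in c r x a y b -> C4_in c r a y b x.
Proof.
case/and5P=> u4 xa ay yb bx; apply/and5P; split=> //.
by rewrite -(rot_uniq 3).
Qed.

(** Here and below, infinitely many means that every finite list [S] can be avoided, which is the
    form needed to choose disjoint pieces one after another. *)
Definition infdeg (c : coloring) (u : V) (r : bool) : Prop :=
  forall S : seq V, exists2 a, a \notin S & edge_in c r u a.

Definition infpet (c : coloring) (u : V) (r : bool) : Prop :=
  forall S : seq V, exists a y b, C4_in c r u a y b /\ ~~ has (mem S) [:: a; y; b].

Definition infbranch (c : coloring) (u : V) (r : bool) : Prop :=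
  forall S : seq V, exists a, [/\ a \notin S, edge_in c r u a & infdeg c a r].

Lemma edge_in_pull c e r x y : chart e ->
  edge_in (pull c e) r x y -> edge_in c r (e x) (e y).
Proof. by move=> [_ He] /andP[/He xy cxy]; rewrite /edge_in xy. Qed.

Lemma C4_in_pull c e r x a y b : chart e ->
  C4_in (pull c e) r x a y b -> C4_in c r (e x) (e a) (e y) (e b).
Proof.
move=> He /and5P[u4 xa ay yb bx]; apply/and5P.
split; try exact: edge_in_pull.
by rewrite -[uniq _](map_inj_uniq (proj1 He)) in u4.
Qed.

Lemma finite_preimage (e : V -> V) (S : seq V) : injective e ->
  exists S' : seq V, forall x, e x \in S -> x \in S'.
Proof.
move=> inj_e; elim: S => [|s S [S' HS']]; first by exists [::].
have [[x0 Ex0]|no_x] := classic (exists x, e x = s).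
  exists (x0 :: S') => x; rewrite !inE => /predU1P[Ex|/HS' ->]; last by rewrite orbT.
  by rewrite (inj_e x x0) ?eqxx // Ex.
exists S' => x; rewrite inE => /predU1P[Ex|/HS' //].
by case: no_x; exists x.
Qed.

Lemma infdeg_pull c e u r : chart e -> infdeg (pull c e) u r -> infdeg c (e u) r.
Proof.
move=> He Hu S; have [S' HS'] := finite_preimage S (proj1 He).
have [a aS' ua] := Hu S'; exists (e a); last exact: edge_in_pull.
by apply: contra aS' => /HS'.
Qed.

Lemma infpet_pull c e u r : chart e -> infpet (pull c e) u r -> infpet c (e u) r.
Proof.
move=> He Hu S; have [S' HS'] := finite_preimage S (proj1 He).
have [a [y [b [uayb dS]]]] := Hu S'; exists (e a), (e y), (e b).
split; first exact: C4_in_pull.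
apply: contra dS => /= /or4P[] // /HS' ->; by rewrite ?orbT.
Qed.

Definition v0 : V := inl o0.
Definition v1 : V := inl o1.

(* [tail] maps the outer face to its subface on the corners 0 and 1, and [zoom]
   maps it to a face that shares only the corner 0 with the outer face. *)
Definition tail : V -> V := sub_face o2.
Definition zoom : V -> V := sub_face o1 \o sub_face o2.

Lemma chart_tail j : chart (iter j tail).
Proof. by apply: chart_iter; exact: chart_sub_face. Qed.

Lemma chart_zoom j : chart (iter j zoom).
Proof.
by apply: chart_iter; apply: chart_comp (chart_sub_face _) (chart_sub_face _).
Qed.

Lemma tail_v0 j : iter j tail v0 = v0. Proof. by elim: j => //= j ->. Qed.
Lemma tail_v1 j : iter j tail v1 = v1. Proof. by elim: j => //= j ->. Qed.
Lemma zoom_v0 j : iter j zoom v0 = v0. Proof. by elim: j => //= j ->. Qed.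

(** Iterating [tail] drives every vertex except the two fixed corners out of any finite set; [zoom]
    does so for every vertex except [v0]. *)
Lemma ht_tail j x : x != v0 -> x != v1 -> ht (iter j tail x) = ht x + j.
Proof.
move=> x0 x1; elim: j => [|j IHj]; first by rewrite addn0.
have H z : z != v0 -> z != v1 -> ht (tail z) = (ht z).+1.
  by case: z => [k|s] //=; move: k; apply: ord3P.
have inj_t := proj1 (chart_tail j).
rewrite iterS H ?IHj ?addnS //.
  by rewrite -[v0](tail_v0 j) (inj_eq inj_t).
by rewrite -[v1](tail_v1 j) (inj_eq inj_t).
Qed.

Lemma ht_zoom j x : x != v0 -> j <= ht (iter j zoom x).
Proof.
move=> x0; elim: j => // j IHj.
have H z : z != v0 -> ht z < ht (zoom z).
  by case: z => [k|s] //=; move: k; apply: ord3P.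
apply: leq_ltn_trans IHj (H _ _).
by rewrite -[v0](zoom_v0 j) (inj_eq (proj1 (chart_zoom j))).
Qed.

Definition max_ht (S : seq V) : nat := foldr maxn 0 (map ht S).

Lemma max_htP S x : max_ht S < ht x -> x \notin S.
Proof.
elim: S => [//|s S IHs]; rewrite /max_ht /= gtn_max inE negb_or => /andP[lt_s /IHs ->].
by rewrite andbT; apply: contraTneq lt_s => ->; rewrite ltnn.
Qed.

(** Greedy choice: each new list avoids the union of the earlier ones. *)
Lemma avoid_seq k (Q : seq V -> Prop) :
  (forall S : seq V, exists2 s, Q s & ~~ has (mem S) s) ->
  exists g : nat -> seq V, (forall i, i < k -> Q (g i)) /\
    (forall i j, i < k -> j < k -> i != j -> ~~ has (mem (g i)) (g j)).
Proof.
move=> HQ; elim: k => [|k [g [Qg dg]]]; first by exists (fun=> [::]).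
have [s Qs ds] := HQ (flatten (mkseq g k)).
have ds' i : i < k -> ~~ has (mem (g i)) s.
  move=> lt_i; apply: contra ds => /hasP[x xs xg]; apply/hasP; exists x => //.
  by apply/flattenP; exists (g i) => //; rewrite map_f ?mem_iota.
exists (fun i => if i == k then s else g i); split=> [i|i j].
  by rewrite ltnS leq_eqVlt; case: eqP => //= _; exact: Qg.
rewrite !ltnS (leq_eqVlt i) (leq_eqVlt j).
case: (eqVneq i k) => [->|ik] /= lt_i; case: (eqVneq j k) => [->|jk] //= lt_j ij.
- by rewrite has_sym ds'.
- by rewrite ds'.
- exact: dg.
Qed.

Lemma infdeg_leaves c u r k (S : seq V) : infdeg c u r ->
  exists s, [/\ size s = k, uniq s, all (edge_in c r u) s & ~~ has (mem S) s].
Proof.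
move=> Hu; elim: k => [|k [s [sz_s uniq_s adj_s dS]]]; first by exists [::].
have [a aS ua] := Hu (s ++ S); exists (a :: s); split=> /=.
- by rewrite sz_s.
- by rewrite uniq_s andbT; apply: contra aS; rewrite mem_cat => ->.
- by rewrite ua.
- by rewrite (negPf dS) orbF; apply: contra aS; rewrite mem_cat => ->; rewrite orbT.
Qed.

(** Cuts the jellyfish minus its center into [k] blocks of [k + 4] vertices: positions 0 to 2 are a
    petal, 3 is a child of the root, the rest are the leaves of this child. *)
Definition jelly_code (k : nat) (x : jellyfish k) : option ('I_k * nat) :=
  match x with
  | inl None => None
  | inl (Some (i, v)) => Some (i, val v)
  | inr w => match val w with
    | None => None
    | Some (i, None) => Some (i, 3)
    | Some (i, Some j) => Some (i, j.+4)
    end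
  end.

Lemma jelly_code_inj k : injective (@jelly_code k).
Proof.
case=> [[[i v]|]|[[[i [j|]]|] w]] [[[i' v']|]|[[[i' [j'|]]|] w']] //=.
- by case=> -> /val_inj ->.
- by case=> _ E; have := ltn_ord v; rewrite E.
- by case=> _ E; have := ltn_ord v; rewrite E.
- by case=> _ E; have := ltn_ord v'; rewrite -E.
- by case=> Ei Ej; congr inr; apply: val_inj; rewrite /= Ei (val_inj Ej).
- by case=> _ E; have := ltn_ord v'; rewrite -E.
- by case=> Ei; congr inr; apply: val_inj; rewrite /= Ei.
Qed.

Lemma jelly_code_lt k x i p : @jelly_code k x = Some (i, p) -> p < k.+4.
Proof.
case: x => [[[i' v]|]|[[[i' [j|]]|] w]] //= [_ <-] //.
  exact: leq_trans (ltn_ord v) _.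
by rewrite !ltnS.
Qed.

(** One block is a 4-cycle at [u], a neighbor of [u] of infinite degree and [k] further neighbors of
    the latter. Each piece can avoid any finite set, so [k] disjoint blocks exist. *)
Lemma jellyfish_mono c u r k : sym_col c -> infpet c u r -> infbranch c u r ->
  has_mono c (jellyfish k).
Proof.
move=> c_sym pet_u br_u.
pose N s := nth u s.
pose Q s := [/\ size s = k.+4, uniq (u :: s), C4_in c r u (N s 0) (N s 1) (N s 2),
  edge_in c r u (N s 3) & forall j : 'I_k, edge_in c r (N s 3) (N s j.+4)].
have HQ (S : seq V) : exists2 s, Q s & ~~ has (mem S) s.
  have [a [y [b [C d1]]]] := pet_u S.
  have uniq4 : uniq [:: u; a; y; b] by case/and5P: C.
  have [a' [d2 ua' da']] := br_u ([:: u; a; y; b] ++ S).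
  rewrite mem_cat negb_or in d2; case/andP: d2 => d2 d2'.
  have [l [sz_l uniq_l adj_l d3]] := infdeg_leaves k (a' :: [:: u; a; y; b] ++ S) da'.
  have {}d3 z : z \in l -> [/\ z != a', z \notin [:: u; a; y; b] & z \notin S].
    move/(hasPn d3); rewrite /= !inE !negb_or.
    by case/andP=> -> /and5P[-> -> -> -> ->].
  exists ([:: a; y; b; a'] ++ l); last first.
    have dl : ~~ has (mem S) l by apply/hasPn => z /d3[].
    by move: d1; rewrite has_cat !negb_or dl /= (negPf d2') ?orbF ?andbT.
  split=> //.
  - by rewrite /= sz_l.
  - rewrite -[_ :: _]/([:: u; a; y; b] ++ a' :: l) cat_uniq uniq4.
    have d4 : ~~ has (mem [:: u; a; y; b]) (a' :: l).
      by apply/hasPn => z; rewrite inE => /predU1P[-> //|/d3[]].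
    by rewrite d4 cons_uniq uniq_l andbT; apply/negP => /d3[/eqP].
  - by move=> j; apply: (allP adj_l (nth u l j)); rewrite mem_nth ?sz_l.
have [g [Qg dg]] := avoid_seq k HQ.
pose f (x : jellyfish k) := if jelly_code x is Some (i, p) then N (g i) p else u.
have fE x i p : jelly_code x = Some (i, p) -> f x = N (g i) p by rewrite /f => ->.
have fN x : jelly_code x = None -> f x = u by rewrite /f => ->.
have f_in x i p : jelly_code x = Some (i, p) -> f x \in g i /\ f x != u.
  move=> Ex; have [sz_g /andP[u_g _] _ _ _] := Qg _ (ltn_ord i).
  have fg : f x \in g i by rewrite (fE _ _ _ Ex) mem_nth // sz_g (jelly_code_lt Ex).
  by split=> //; apply: contraNneq u_g => <-.
exists f, r; split=> [x y|].
  case Ex: (jelly_code x) => [[i p]|]; case Ey: (jelly_code y) => [[j q]|].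
  - move=> Exy; have [xg _] := f_in _ _ _ Ex; have [yg _] := f_in _ _ _ Ey.
    have Eij : i = j.
      apply/eqP; rewrite -val_eqE /=; apply: contraT => ij.
      have /hasPn/(_ _ yg) := dg _ _ (ltn_ord i) (ltn_ord j) ij.
      by rewrite /= -Exy xg.
    subst j; have [sz_g /andP[_ u_g] _ _ _] := Qg _ (ltn_ord i).
    move/eqP: Exy; rewrite (fE _ _ _ Ex) (fE _ _ _ Ey).
    rewrite nth_uniq ?sz_g ?(jelly_code_lt Ex) ?(jelly_code_lt Ey) // => /eqP Epq.
    by apply: jelly_code_inj; rewrite Ex Ey Epq.
  - by have [_ /eqP H] := f_in _ _ _ Ex; rewrite (fN _ Ey).
  - by have [_ /eqP H] := f_in _ _ _ Ey; rewrite (fN _ Ex) => E; case: H.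
  - by move=> _; apply: jelly_code_inj; rewrite Ex Ey.
suff H x y : adj x y -> edge_in c r (f x) (f y).
  by move=> x y /H /andP[-> /eqP].
have pet (i : 'I_k) : [/\ edge_in c r u (N (g i) 0),
    edge_in c r (N (g i) 0) (N (g i) 1), edge_in c r (N (g i) 1) (N (g i) 2)
    & edge_in c r (N (g i) 2) u].
  by have [_ _ /and5P[]] := Qg _ (ltn_ord i).
have br (i : 'I_k) : edge_in c r u (N (g i) 3) /\
    forall j : 'I_k, edge_in c r (N (g i) 3) (N (g i) j.+4).
  by have [] := Qg _ (ltn_ord i).
suff H' : adj x y -> edge_in c r (f x) (f y) || edge_in c r (f y) (f x).
  by case/H'/orP => //; rewrite (edge_in_sym _ _ _ c_sym).
case: x y => [[[i v]|]|[[[i [j|]]|] w]] [[[i' v']|]|[[[i' [j'|]]|] w']] //=.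
- case/andP=> /eqP <-; have [_ H1 H2 _] := pet i.
  move: v v'; apply: ord3P; apply: ord3P => // _; rewrite /f /= ?H1 ?H2 ?orbT //.
- have [H1 _ _ H2] := pet i.
  by move: v; apply: ord3P => // _; rewrite /f /= ?H1 ?H2 ?orbT.
- have [H1 _ _ H2] := pet i'.
  by move: v'; apply: ord3P => // _; rewrite /f /= ?H1 ?H2 ?orbT.
- by rewrite /f /= (proj1 (br i')).
- by move/eqP=> <-; rewrite /f /= (proj2 (br i)) orbT.
- by rewrite /f /= (proj1 (br i)) orbT.
- by move/eqP=> <-; rewrite /f /= (proj2 (br i)).
Qed.

Definition leaf_index (k : nat) (w : {z : star k | z != None}) : nat :=
  if val w is Some j then val j else 0.

Lemma leaf_index_inj k : injective (@leaf_index k).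
Proof.
case=> [[i|] Hi] [[j|] Hj] //= E; apply: val_inj; congr Some; exact: val_inj.
Qed.

Lemma leaf_index_lt k w : @leaf_index k w < k.
Proof. by case: w => [[i|] Hi] //; exact: ltn_ord. Qed.

(** The position in the list made of the 4-cycle, then the [k] leaves of its vertex 0, then the [k]
    leaves of its vertex 2. *)
Definition bistar_code (k : nat) (z : bistar k) : nat :=
  match z with
  | inl (inl i) => val i
  | inl (inr w) => 4 + leaf_index w
  | inr w => 4 + (k + leaf_index w)
  end.

Lemma bistar_code_inj k : injective (@bistar_code k).
Proof.
have ltk (w : {z : star k | z != None}) j : leaf_index w = k + j -> False.
  by move=> E; have := leaf_index_lt w; rewrite E ltnNge leq_addr.
case=> [[i|w]|w] [[j|w']|w'] /= E.
- by rewrite (val_inj E).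
- by have := ltn_ord i; rewrite E ltnNge leq_addr.
- by have := ltn_ord i; rewrite E ltnNge leq_addr.
- by have := ltn_ord j; rewrite -E ltnNge leq_addr.
- by rewrite (leaf_index_inj (addnI E)).
- by case: (ltk w _ (addnI E)).
- by have := ltn_ord j; rewrite -E ltnNge leq_addr.
- by case: (ltk w' _ (addnI (esym E))).
- by rewrite (leaf_index_inj (addnI (addnI E))).
Qed.

Lemma bistar_mono c r x a y b k : sym_col c -> C4_in c r x a y b ->
  infdeg c x r -> infdeg c y r -> has_mono c (bistar k).
Proof.
move=> c_sym C dx dy; have [uniq4 xa ay yb bx] := and5P C.
have [s [sz_s uniq_s adj_s d_s]] := infdeg_leaves k [:: x; a; y; b] dx.
have [t [sz_t uniq_t adj_t d_t]] := infdeg_leaves k ([:: x; a; y; b] ++ s) dy.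
pose l := ([:: x; a; y; b] ++ s) ++ t.
have uniq_l : uniq l by rewrite !cat_uniq uniq4 uniq_s d_s d_t uniq_t.
have sz_l : size l = 4 + (k + k) by rewrite !size_cat sz_s sz_t addnA.
pose f (z : bistar k) := nth x l (bistar_code z).
have lt_code (z : bistar k) : bistar_code z < size l.
  rewrite sz_l; case: z => [[i|w]|w] /=.
  - exact: leq_trans (ltn_ord i) _.
  - by rewrite ltn_add2l ltn_addl // leaf_index_lt.
  - by rewrite !ltn_add2l leaf_index_lt.
exists f, r; split=> [z z' /eqP|].
  by rewrite nth_uniq // => /eqP /bistar_code_inj.
have fs w : edge_in c r x (f (inl (inr w))).
  rewrite /f /l -catA /= nth_cat sz_s leaf_index_lt.
  by apply: (allP adj_s); rewrite mem_nth ?sz_s ?leaf_index_lt.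
have ft w : edge_in c r y (f (inr w)).
  rewrite /f /l -catA /= nth_cat sz_s ltnNge leq_addr /= add0n addKn.
  by apply: (allP adj_t); rewrite mem_nth ?sz_t ?leaf_index_lt.
have fx : f (inl (inl (inord 0))) = x by rewrite /f /= inordK.
have fy : f (inl (inl (inord 2))) = y by rewrite /f /= inordK.
suff H z z' : adj z z' -> edge_in c r (f z) (f z').
  by move=> z z' /H /andP[-> /eqP].
suff H' : adj z z' -> edge_in c r (f z) (f z') || edge_in c r (f z') (f z).
  by case/H'/orP=> //; rewrite (edge_in_sym _ _ _ c_sym).
case: z z' => [[i|w]|w] [[j|w']|w'] //=.
- case: i j => [[|[|[|[|i]]]] lt_i] [[|[|[|[|j]]]] lt_j] //= _; rewrite /f /=;
    by rewrite ?xa ?ay ?yb ?bx ?orbT.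
- by case/andP=> /eqP -> _; rewrite fx fs.
- by case/andP=> /eqP [->] _; rewrite fy ft.
- by case/andP=> /eqP -> _; rewrite fx fs orbT.
- by case: w w' => [[i|] Hi] [[j|] Hj].
- by case/andP=> /eqP [->] _; rewrite fy ft orbT.
- by case: w w' => [[i|] Hi] [[j|] Hj].
Qed.

(** * Monochromatic 4-cycles through a corner *)

Definition all_equal (f : nat -> bool) (C : seq nat) : bool :=
  all f C || all (fun i => ~~ f i) C.

(* Exhaustive search: [G] lists, for each variable in turn, the constraints (sets
   of variables that must not all be equal) that this variable completes, and
   [pre] is the current partial assignment. The test is an [if] because [||]
   would not prune the search under the call-by-value [vm_compute]. *)
Fixpoint refute (G : seq (seq (seq nat))) (pre : seq bool) : bool :=
  if G is g :: G' then
    let try b := let p := rcons pre b in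
      if has (fun C => all (fun i => i < size p) C && all_equal (nth false p) C) g
      then true else refute G' p in
    try true && try false
  else false.

(** The search closes both values of every variable, so in particular it closes the branch that
    follows [f], and this happens only at a constraint on which [f] is constant. *)
Lemma refuteP G pre (f : nat -> bool) : refute G pre -> pre = mkseq f (size pre) ->
  exists2 C, C \in flatten G & all_equal f C.
Proof.
elim: G pre => [//|g G IHG] pre /andP[Ht Hf] Epre.
set p := rcons pre (f (size pre)).
have : has (fun C => all (fun i => i < size p) C && all_equal (nth false p) C) g
       || refute G p by rewrite /p; case: (f _).
have Ep : p = mkseq f (size p) by rewrite /p size_rcons mkseqS -Epre.
case/orP=> [/hasP[C Cg /andP[lt_C eq_C]]|/IHG/(_ Ep)[C CG eq_C]].
  exists C; first by rewrite mem_cat Cg.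
  have nthp i : i \in C -> nth false p i = f i.
    by move=> /(allP lt_C) lt_i; rewrite Ep nth_mkseq.
  case/orP: eq_C => /allP eq_C; apply/orP; [left|right]; apply/allP => i Ci.
    by rewrite -nthp // eq_C.
  by rewrite -nthp // eq_C.
by exists C => //; rewrite mem_cat CG orbT.
Qed.

Definition apex (j : nat) : V := iter j tail (inl o2).

Module Gadget.

(* The vertices 0 and 1 are two corners, [apex j] is the vertex 2 for j = 0 and
   3 j for 0 < j <= 4, and 3 j + 4, 3 j + 5 are the centres of the two faces
   between [apex j] and [apex j.+1]. *)
Definition verts : seq V := [:: v0, v1, inl o2 & flatten
  (mkseq (fun j => map (iter j tail) [:: inr [::]; inr [:: o1]; inr [:: o0]]) 4)].

Definition apexes : seq nat := [:: 2; 3; 6; 9; 12].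

Definition edges : seq (nat * nat) := [:: (0, 1), (0, 2), (1, 2) & flatten
  (mkseq (fun j =>
     let w := nth 0 apexes j in let x := 3 * j + 3 in let y := x.+1 in let z := x.+2 in
     [:: (0, x); (1, x); (w, x); (0, y); (w, y); (x, y); (1, z); (w, z); (x, z)]) 4)].

Definition idx (a b : nat) : nat := index (minn a b, maxn a b) edges.
Definition is_edge (a b : nat) : bool := (minn a b, maxn a b) \in edges.
Definition vert (a : nat) : V := nth v0 verts a.

Definition cycles : seq (nat * nat * nat * nat) :=
  [seq t <- [seq (t.1, t.2, q) |
               t <- [seq (p, x) | p <- [seq (o, p) | o <- [:: 0; 1], p <- iota 0 15],
                                  x <- iota 0 15],
               q <- iota 0 15] |
     let: (o, p, x, q) := t in
     [&& o < 2, uniq [:: o; p; x; q], is_edge o p, is_edge p x, is_edge x q & is_edge q o]].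

Definition cycle_constraint (t : nat * nat * nat * nat) : seq nat :=
  let: (o, p, x, q) := t in [:: idx o p; idx p x; idx x q; idx q o].

(** An assignment meeting all of these has no monochromatic 4-cycle through vertex 0 or 1 and no
    apex whose edges to 0 and 1 agree in color. *)
Definition constraints : seq (seq nat) :=
  map cycle_constraint cycles ++ [seq [:: idx 0 w; idx 1 w] | w <- apexes].

(** Each constraint is filed under its largest variable, the one whose assignment completes it. *)
Definition grouped : seq (seq (seq nat)) :=
  mkseq (fun k => [seq C <- constraints | foldr maxn 0 C == k]) (size edges).

Lemma refuted : refute grouped [::].
Proof. by vm_compute. Qed.

Lemma edges_ok : all (fun p => [&& p.1 < 15, p.2 < 15 & vadj (vert p.1) (vert p.2)]) edges.
Proof. by []. Qed.

Lemma verts_uniq : uniq verts.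
Proof. by []. Qed.

Lemma apexes_ok : all (fun i => (vert (nth 0 apexes i) == apex i) &&
  is_edge 0 (nth 0 apexes i) && is_edge 1 (nth 0 apexes i)) (iota 0 5).
Proof. by []. Qed.

End Gadget.

Import Gadget.

Lemma gadget_C4 c : sym_col c ->
  (exists r a y b, C4_in c r v0 a y b \/ C4_in c r v1 a y b) \/
  (exists j r, [/\ j < 5, edge_in c r v0 (apex j) & edge_in c r v1 (apex j)]).
Proof.
move=> c_sym.
pose f i := let: (a, b) := nth (0, 0) edges i in c (vert a) (vert b).
have fP a b : is_edge a b ->
    [/\ f (idx a b) = c (vert a) (vert b), vadj (vert a) (vert b), a < 15 & b < 15].
  move=> ab; rewrite /f /idx nth_index //.
  have := allP edges_ok _ ab; rewrite /minn /maxn.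
  case: (ltnP a b) => _ /and3P[/= lt_a lt_b adj_ab]; first by split.
  by split=> //; rewrite 1?c_sym 1?vadj_sym.
have constC C : all_equal f C -> exists r, forall i, i \in C -> f i = r.
  case/orP=> /allP H; [exists true|exists false] => i /H //.
  by case: (f i).
have [C CG /constC[r Hr]] := refuteP (f := f) refuted erefl.
have {}Hr k : k < size C -> f (nth 0 C k) = r by move=> lt_k; rewrite Hr ?mem_nth.
have {CG} : C \in constraints.
  case/flattenP: CG => g /mapP[k _ ->]; by rewrite mem_filter => /andP[].
rewrite mem_cat => /orP[/mapP[[[[o p] x] q] t_cyc EC]|/mapP[w w_apex EC]].
- left; move: t_cyc; rewrite mem_filter => /andP[/andP[lt_o2 /and5P[u4 op px xq qo]] _].
  have [f1 a1 lt_o lt_p] := fP _ _ op; have [f2 a2 _ lt_x] := fP _ _ px.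
  have [f3 a3 _ lt_q] := fP _ _ xq; have [f4 a4 _ _] := fP _ _ qo.
  have HC : C4_in c r (vert o) (vert p) (vert x) (vert q).
    move: EC f1 f2 f3 f4; rewrite /cycle_constraint /C4_in /edge_in a1 a2 a3 a4.
    move: (idx o p) (idx p x) (idx x q) (idx q o) => i1 i2 i3 i4 EC <- <- <- <-.
    rewrite EC in Hr; have /= -> := Hr 0 isT; have /= -> := Hr 1 isT.
    have /= -> := Hr 2 isT; have /= -> := Hr 3 isT; rewrite eqxx !andbT.
    have vI a b : a < 15 -> b < 15 -> (vert a == vert b) = (a == b).
      by move=> lt_a lt_b; rewrite nth_uniq // verts_uniq.
    by move: u4; rewrite /= !inE !vI // andbT.
  exists r, (vert p), (vert x), (vert q).
  by case: o lt_o2 HC {EC u4 op qo lt_o f1 f4 a1 a4} => [|[|o]] // _ HC; [left|right].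
- right; have [i lt_i Ew] : exists2 i, i < 5 & w = nth 0 apexes i.
    by exists (index w apexes); rewrite ?nth_index // -[5]/(size apexes) index_mem.
  have /(allP apexes_ok)/andP[/andP[/eqP Ei e0 e1]] : i \in iota 0 5.
    by rewrite mem_iota.
  rewrite -Ew in Ei e0 e1.
  have [f0 a0 _ _] := fP _ _ e0; have [f1 a1 _ _] := fP _ _ e1.
  exists i, r; rewrite /edge_in -Ei a0 a1 -[v0]/(vert 0) -[v1]/(vert 1) -f0 -f1.
  move: EC; move: (idx 0 w) (idx 1 w) => i0 i1 EC; rewrite EC in Hr.
  by split=> //; apply/eqP; [exact: (Hr 0 isT)|exact: (Hr 1 isT)].
Qed.

(** Otherwise each of three gadgets along the edge [v0 v1] has an apex joined to both corners in one
    color. Two of the three colors agree, and these two apexes form a monochromatic 4-cycle with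
    [v0] and [v1]. *)
Lemma C4_through_corner c : sym_col c ->
  exists r a y b, C4_in c r v0 a y b \/ C4_in c r v1 a y b.
Proof.
move=> c_sym; apply: NNPP => noC.
(* A gadget has the five apexes 0 to 4, so shifting by multiples of 5 makes the apexes of different
   gadgets distinct. *)
have exc i : exists j r, [/\ j < 5, edge_in c r v0 (apex (5 * i + j))
                           & edge_in c r v1 (apex (5 * i + j))].
  have Hch := chart_tail (5 * i).
  case: (gadget_C4 (sym_pull (iter (5 * i) tail) c_sym)) => [[r [a [y [b C]]]]|].
    case: noC; exists r, (iter (5 * i) tail a), (iter (5 * i) tail y), (iter (5 * i) tail b).
    by case: C => /(C4_in_pull Hch); rewrite ?tail_v0 ?tail_v1; [left|right].
  case=> j [r [lt_j e0 e1]]; exists j, r; split=> //; rewrite /apex iterD.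
    by have := edge_in_pull Hch e0; rewrite tail_v0.
  by have := edge_in_pull Hch e1; rewrite tail_v1.
have twice j j' r : j != j' -> edge_in c r v0 (apex j) -> edge_in c r v1 (apex j) ->
    edge_in c r v0 (apex j') -> edge_in c r v1 (apex j') -> False.
  move=> jj' e0 e1 e0' e1'; apply: noC.
  exists r, (apex j), v1, (apex j'); left; rewrite /C4_in e0 e1' /=.
  rewrite edge_in_sym // e1 edge_in_sym // e0' !inE !andbT.
  have n0 := vadj_neq (proj1 (andP e0)); have n1 := vadj_neq (proj1 (andP e1)).
  have n0' := vadj_neq (proj1 (andP e0')); have n1' := vadj_neq (proj1 (andP e1')).
  rewrite eq_sym in n1; rewrite !negb_or n0 n0' n1' n1 /= andbT.
  by apply: contraNneq jj' => /(congr1 ht); rewrite /apex !ht_tail // => /= /eqP.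
have neq i i' j j' : j < 5 -> j' < 5 -> i != i' -> 5 * i + j != 5 * i' + j'.
  move=> lt_j lt_j'; apply: contraNneq => E.
  by have := congr1 (divn^~ 5) E; rewrite /= !(mulnC 5) !divnMDl // !divn_small // !addn0 => ->.
have [j0 [r0 [lt0 a0 b0]]] := exc 0; have [j1 [r1 [lt1 a1 b1]]] := exc 1.
have [j2 [r2 [lt2 a2 b2]]] := exc 2.
have [E|E] : r0 = r1 \/ (r0 = r2 \/ r1 = r2).
  by case: r0 r1 r2 {a0 b0 a1 b1 a2 b2} => [] [] []; auto.
- by subst r1; apply: (twice _ _ _ _ a0 b0 a1 b1); apply: neq.
case: E => E; subst r2.
  by apply: (twice _ _ _ _ a0 b0 a2 b2); apply: neq.
by apply: (twice _ _ _ _ a1 b1 a2 b2); apply: neq.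
Qed.

(** * Unavoidability of jellyfish and bistars *)

Lemma edge_inN c r x y : vadj x y -> ~~ edge_in c r x y -> edge_in c (~~ r) x y.
Proof. by rewrite /edge_in => -> /=; case: (c x y) r => [] []. Qed.

Lemma edge_in_vadj c r x y : edge_in c r x y -> vadj x y.
Proof. by case/andP. Qed.

Lemma edge_in_neq c r x y : edge_in c r x y -> x != y.
Proof. by move/edge_in_vadj/vadj_neq. Qed.

Lemma C4_inI c r x a y b : sym_col c -> edge_in c r x a -> edge_in c r y a ->
  edge_in c r y b -> edge_in c r x b -> x != y -> a != b -> C4_in c r x a y b.
Proof.
move=> c_sym xa ya yb xb xy ab; have := edge_in_neq ya; rewrite eq_sym => ay.
rewrite /C4_in xa yb (edge_in_sym _ a) // ya (edge_in_sym _ b) // xb.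
by rewrite /= !inE !negb_or xy ab ay !(edge_in_neq xa, edge_in_neq xb, edge_in_neq yb).
Qed.

Lemma apex_v0 j : vadj v0 (apex j).
Proof. by rewrite -(tail_v0 j); apply: (proj2 (chart_tail j)). Qed.

Lemma apex_v1 j : vadj v1 (apex j).
Proof. by rewrite -(tail_v1 j); apply: (proj2 (chart_tail j)). Qed.

Lemma apex_succ j : vadj (apex j) (apex j.+1).
Proof. by rewrite /apex iterSr; apply: (proj2 (chart_tail j)). Qed.

Lemma apex_notin (S : seq V) j : max_ht S < j -> apex j \notin S.
Proof. by move=> lt_j; apply: max_htP; rewrite ht_tail. Qed.

Lemma tail_notin (S : seq V) j x : max_ht S < j -> x != v0 -> x != v1 ->
  iter j tail x \notin S.
Proof.
by move=> lt_j x0 x1; apply: max_htP; rewrite ht_tail // ltn_addl.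
Qed.

Lemma zoom_notin (S : seq V) j x : max_ht S < j -> x != v0 -> iter j zoom x \notin S.
Proof. by move=> lt_j /(ht_zoom j) le_j; apply: max_htP; apply: leq_trans le_j. Qed.

(** Carrying the edge to [v0 v1], the apexes are infinitely many common neighbors. *)
Lemma common_nbr x y (S : seq V) : vadj x y ->
  exists w, [/\ w \notin S, vadj x w & vadj y w].
Proof.
move=> /chart_edge[e [[inj_e adj_e] <- <-]]; have [S' HS'] := finite_preimage S inj_e.
exists (e (apex (max_ht S').+1)); split.
- by apply: contra (apex_notin (ltnSn (max_ht S'))) => /HS'.
- by apply: adj_e; exact: apex_v0.
- by apply: adj_e; exact: apex_v1.
Qed.

Lemma ex_nbr x : exists y, vadj x y.
Proof.
case: x => [i|s]; last by exists (bd s o0); exact: vadj_bd.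
by move: i; apply: ord3P; [exists v1|exists v0|exists v0].
Qed.

Definition cofinite (c : coloring) (u : V) (r : bool) : Prop :=
  exists S : seq V, forall x, vadj u x -> x \notin S -> edge_in c r u x.

Lemma cofinite_infdeg c u r : cofinite c u r -> infdeg c u r.
Proof.
move=> [S HS] S'; have [y uy] := ex_nbr u.
have [w [wS uw _]] := common_nbr (S ++ S') uy.
by move: wS; rewrite mem_cat negb_or => /andP[wS wS']; exists w => //; exact: HS.
Qed.

Lemma not_infdeg c u r : ~ infdeg c u r -> cofinite c u (~~ r).
Proof.
move/not_all_ex_not=> [S HS]; exists S => x ux xS.
by apply: edge_inN => //; apply/negP => ux'; apply: HS; exists x.
Qed.

(** * Colorings with a corner whose edges all have one color *)

Definition pure (c : coloring) (r : bool) : Prop :=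
  forall x, vadj v0 x -> edge_in c r v0 x.

Lemma pure_pull c e r : chart e -> e v0 = v0 -> pure c r -> pure (pull c e) r.
Proof.
move=> [_ adj_e] e0 Hp x v0x; have := Hp (e x); rewrite -{1}e0 => /(_ (adj_e _ _ v0x)).
by rewrite /edge_in v0x /pull e0 => /andP[].
Qed.

Definition no_C4_v0 (c : coloring) (r : bool) : Prop :=
  forall a y b, ~~ C4_in c r v0 a y b.

Lemma no_C4_v0_pull c e r : chart e -> e v0 = v0 -> no_C4_v0 c r ->
  no_C4_v0 (pull c e) r.
Proof.
move=> He e0 noC a y b; apply/negP => /(C4_in_pull He); rewrite e0.
exact: (negP (noC _ _ _)).
Qed.

(** Zooming towards [v0] leaves the finite blocking set behind, so a lack of infinitely many
    4-cycles becomes a lack of any. The same device serves for branches below. *)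
Lemma not_infpet_v0 c r : ~ infpet c v0 r ->
  exists j, no_C4_v0 (pull c (iter j zoom)) r.
Proof.
move/not_all_ex_not=> [S HS]; exists (max_ht S).+1 => a y b; apply/negP => C.
apply: HS; have := C4_in_pull (chart_zoom _) C; rewrite zoom_v0 => C'.
do 3!eexists; split; first exact: C'.
case/and5P: C => /andP[]; rewrite !inE !negb_or => /and3P[a0 y0 b0] _ _ _ _ _.
by apply/and4P; split=> //; apply: zoom_notin; rewrite // eq_sym.
Qed.

Lemma not_infbranch_v0 c r : ~ infbranch c v0 r ->
  exists j, forall a, edge_in (pull c (iter j zoom)) r v0 a ->
    ~ infdeg (pull c (iter j zoom)) a r.
Proof.
move/not_all_ex_not=> [S HS]; exists (max_ht S).+1 => a v0a da.
apply: HS; exists (iter (max_ht S).+1 zoom a); split.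
- by apply: zoom_notin => //; rewrite eq_sym (vadj_neq (edge_in_vadj v0a)).
- by have := edge_in_pull (chart_zoom _) v0a; rewrite zoom_v0.
- exact: infdeg_pull (chart_zoom _) da.
Qed.

Section Pure.
Variables (c : coloring) (r : bool).
Hypotheses (c_sym : sym_col c) (c_pure : pure c r).

(** Two edges of color [r] from [x] to neighbors of [v0] would close a 4-cycle of color [r] through
    [v0]. *)
Lemma pure_unique x p q : no_C4_v0 c r -> x != v0 -> p != q ->
  vadj v0 p -> vadj v0 q -> edge_in c r x p -> ~~ edge_in c r x q.
Proof.
move=> noC x0 pq v0p v0q xp; apply/negP => xq.
apply: (negP (noC p x q)); apply: C4_inI => //; try exact: c_pure.
by rewrite eq_sym.
Qed.

Lemma apex_eventually : no_C4_v0 c r ->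
  exists j0, forall j, j0 <= j -> edge_in c (~~ r) v1 (apex j).
Proof.
move=> noC; have [[j0 Hj0]|no_j] := classic (exists j, edge_in c r v1 (apex j)).
  exists j0.+1 => j lt_j; apply: edge_inN; first exact: apex_v1.
  apply: pure_unique Hj0 => //; try exact: apex_v0.
  apply: contraTneq lt_j => /(congr1 ht); rewrite !ht_tail //= !add0n => ->.
  by rewrite ltnn.
exists 0 => j _; apply: edge_inN; first exact: apex_v1.
by apply/negP => Hj; apply: no_j; exists j.
Qed.

End Pure.

(** If two consecutive apexes are joined in color [r], then by [pure_unique] the centre of the face
    they form with [v0] is joined to both in the other color, and it closes the cycle through [v1].
    If neither pair is so joined, [v1] and the three apexes form the cycle. *)
Lemma petal_local c r : sym_col c -> pure c r -> no_C4_v0 c r ->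
  (forall j, j < 3 -> edge_in c (~~ r) v1 (apex j)) ->
  exists a y b, C4_in c (~~ r) v1 a y b /\
    all (fun z => [&& vadj v0 z, z != v0 & z != v1]) [:: a; y; b].
Proof.
move=> c_sym c_pure noC Hw.
pose w0 := apex 0; pose w1 := apex 1; pose w2 := apex 2.
have use_centre (p q y : V) : edge_in c (~~ r) v1 p -> edge_in c (~~ r) v1 q ->
    edge_in c r p q -> vadj v0 p -> vadj v0 q -> vadj v0 y -> vadj y p -> vadj y q ->
    p != v0 -> q != v0 -> y != v1 -> C4_in c (~~ r) v1 p y q.
  move=> v1p v1q pq v0p v0q v0y yp yq p0 q0 y1.
  have pq' := vadj_neq (edge_in_vadj pq).
  apply: C4_inI => //; try by rewrite eq_sym.
    rewrite edge_in_sym //; apply: edge_inN; first by rewrite vadj_sym.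
    by apply: pure_unique pq => //; rewrite eq_sym (vadj_neq yq).
  rewrite edge_in_sym //; apply: edge_inN; first by rewrite vadj_sym.
  rewrite edge_in_sym // in pq.
  by apply: pure_unique pq => //; rewrite eq_sym (vadj_neq yp).
have [e01|e01] := boolP (edge_in c r w0 w1).
  exists w0, (inr [:: o1]), w1; split=> //.
  by apply: use_centre => //; exact: Hw.
have [e12|e12] := boolP (edge_in c r w1 w2).
  exists w1, (inr [:: o2; o1]), w2; split=> //.
  by apply: use_centre => //; exact: Hw.
exists w0, w1, w2; split=> //; apply: C4_inI => //; try exact: Hw.
  by rewrite edge_in_sym //; exact: edge_inN.
exact: edge_inN.
Qed.

Lemma petal_in_link c r (S : seq V) : sym_col c -> pure c r -> no_C4_v0 c r ->
  exists a y b, [/\ C4_in c (~~ r) v1 a y b, ~~ has (mem S) [:: a; y; b]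
    & all (vadj v0) [:: a; y; b]].
Proof.
move=> c_sym c_pure noC; have [j0 Hj0] := apex_eventually c_sym c_pure noC.
pose j := maxn j0 (max_ht S).+1; have Ht := chart_tail j.
have lt_j : max_ht S < j by exact: leq_maxr.
have [] := @petal_local (pull c (iter j tail)) r.
- exact: sym_pull.
- by apply: pure_pull => //; exact: tail_v0.
- by apply: no_C4_v0_pull => //; exact: tail_v0.
- move=> i _; have := Hj0 (j + i) (leq_trans (leq_maxl _ _) (leq_addr _ _)).
  by case/andP=> _; rewrite /edge_in apex_v1 /pull tail_v1 /apex iterD.
move=> a [y [b [C /and4P[/and3P[a0 na na'] /and3P[y0 ny ny'] /and3P[b0 nb nb'] _]]]].
have := C4_in_pull Ht C; rewrite tail_v1 => C'.
do 3!eexists; split; first exact: C'.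
  by apply/hasPn => z; rewrite !inE => /or3P[] /eqP ->; apply: tail_notin.
have adj0 z : vadj v0 z -> vadj v0 (iter j tail z).
  by rewrite -{2}(tail_v0 j); exact: (proj2 Ht).
by apply/and4P; split=> //; exact: adj0.
Qed.

Lemma link_infdeg c r u : sym_col c -> pure c r -> no_C4_v0 c r -> vadj v0 u ->
  infdeg c u (~~ r).
Proof.
move=> c_sym c_pure noC /chart_edge[e [He e0 <-]]; apply: (infdeg_pull He) => S.
have [j0 Hj0] := apex_eventually (sym_pull e c_sym) (pure_pull He e0 c_pure)
  (no_C4_v0_pull He e0 noC).
exists (apex (maxn j0 (max_ht S).+1)); last by apply: Hj0; exact: leq_maxl.
by apply: apex_notin; exact: leq_maxr.
Qed.

Lemma no_C4_jellyfish c r k : sym_col c -> pure c r -> no_C4_v0 c r ->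
  has_mono c (jellyfish k).
Proof.
move=> c_sym c_pure noC; apply: (@jellyfish_mono c v1 (~~ r)) => // S.
  by have [a [y [b [C dS _]]]] := petal_in_link S c_sym c_pure noC; exists a, y, b.
have [j0 Hj0] := apex_eventually c_sym c_pure noC.
exists (apex (maxn j0 (max_ht S).+1)); split.
- by apply: apex_notin; exact: leq_maxr.
- by apply: Hj0; exact: leq_maxl.
- by apply: (link_infdeg c_sym c_pure noC); exact: apex_v0.
Qed.

(** A jellyfish centered at [v1]: consecutive apexes are adjacent and cofinite in color [r], so they
    have a common neighbor outside all exceptions, which completes a petal. The apexes also serve as
    branches. *)
Lemma cofinite_nbrs_jellyfish c r k : sym_col c ->
  (forall a, vadj v0 a -> cofinite c a r) -> has_mono c (jellyfish k).
Proof.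
move=> c_sym cof; have [S1 HS1] := cof v1 isT.
have Hw S j : max_ht (S ++ S1) < j -> edge_in c r v1 (apex j) /\ apex j \notin S.
  move/apex_notin; rewrite mem_cat negb_or => /andP[jS jS1].
  by split=> //; apply: HS1 => //; exact: apex_v1.
apply: (@jellyfish_mono c v1 r) => // S; pose j := (max_ht (S ++ S1)).+1.
  have [v1p pS] := Hw S j (ltnSn _); have [v1q qS] := Hw S j.+1 (leqnSn _).
  have [Sp HSp] := cof _ (apex_v0 j); have [Sq HSq] := cof _ (apex_v0 j.+1).
  have [z [zS pz qz]] := common_nbr (v1 :: S ++ Sp ++ Sq) (apex_succ j).
  move: zS; rewrite inE !mem_cat !negb_or => /and4P[z1 zS zSp zSq].
  exists (apex j), z, (apex j.+1); split; last by rewrite /= !negb_or pS zS qS.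
  apply: C4_inI => //; last exact: vadj_neq (apex_succ j).
  - by rewrite edge_in_sym //; exact: HSp.
  - by rewrite edge_in_sym //; exact: HSq.
  - by rewrite eq_sym.
have [v1p pS] := Hw S j (ltnSn _); exists (apex j); split=> //.
by apply: cofinite_infdeg; apply: cof; exact: apex_v0.
Qed.

(** If [v0] lacks petals or branches in color [r], zooming makes the lack total, and a jellyfish of
    the other color appears at [v1]. *)
Lemma pure_jellyfish c r k : sym_col c -> pure c r -> has_mono c (jellyfish k).
Proof.
move=> c_sym c_pure.
have zoom_pure j : pure (pull c (iter j zoom)) r.
  by apply: pure_pull => //; [exact: chart_zoom|exact: zoom_v0].
have [pet|/not_infpet_v0[j noC]] := classic (infpet c v0 r); last first.
  apply: has_mono_pull (chart_zoom j) _.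
  by apply: no_C4_jellyfish noC => //; exact: sym_pull.
have [br|/not_infbranch_v0[j Hj]] := classic (infbranch c v0 r).
  exact: jellyfish_mono pet br.
apply: has_mono_pull (chart_zoom j) _.
apply: (@cofinite_nbrs_jellyfish _ (~~ r)) => [|a v0a]; first exact: sym_pull.
by apply: not_infdeg; apply: Hj; exact: zoom_pure.
Qed.

Lemma cofinite_pair_bistar c r u w k : sym_col c -> vadj u w ->
  cofinite c u r -> cofinite c w r -> has_mono c (bistar k).
Proof.
move=> c_sym uw cu cw; have [Su HSu] := cu; have [Sw HSw] := cw.
have [y [yS uy wy]] := common_nbr (Su ++ Sw) uw.
have [z [zS uz wz]] := common_nbr (y :: Su ++ Sw) uw.
move: zS yS; rewrite inE !mem_cat !negb_or => /and3P[zy zSu zSw] /andP[ySu ySw].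
apply: (@bistar_mono c r u y w z) => //; try exact: cofinite_infdeg.
apply: C4_inI => //; try exact: HSu; try exact: HSw; last by rewrite eq_sym.
exact: vadj_neq.
Qed.

(** If [y p] or [y q] has color [s], then [u] and that end are opposite on a 4-cycle of color [s];
    otherwise [p y q v] is a 4-cycle of the other color. *)
Lemma kite_bistar c s u v p q y k : sym_col c ->
  edge_in c s u p -> edge_in c s u q -> edge_in c s u y -> edge_in c s p q ->
  edge_in c (~~ s) v p -> edge_in c (~~ s) v q -> vadj y p -> vadj y q -> v != y ->
  infdeg c u s -> infdeg c p s -> infdeg c q s ->
  infdeg c p (~~ s) -> infdeg c q (~~ s) -> has_mono c (bistar k).
Proof.
move=> c_sym up uq uy pq vp vq yp yq vy du dp dq dp' dq'.
have qp : edge_in c s q p by rewrite edge_in_sym.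
have [yp'|yp'] := boolP (edge_in c s y p).
  apply: (@bistar_mono c s u y p q) => //; apply: C4_inI => //.
  - by rewrite edge_in_sym.
  - exact: edge_in_neq up.
  - exact: vadj_neq.
have [yq'|yq'] := boolP (edge_in c s y q).
  apply: (@bistar_mono c s u y q p) => //; apply: C4_inI => //.
  - by rewrite edge_in_sym.
  - exact: edge_in_neq uq.
  - exact: vadj_neq.
apply: (@bistar_mono c (~~ s) p y q v) => //; apply: C4_inI => //.
- by rewrite edge_in_sym //; exact: edge_inN.
- by rewrite edge_in_sym //; exact: edge_inN.
- by rewrite edge_in_sym.
- by rewrite edge_in_sym.
- exact: edge_in_neq pq.
- by rewrite eq_sym.
Qed.

(** By [cofinite_pair_bistar] a common neighbor of [v0] and [v1] with finite degree in some color
    already gives a bistar. Otherwise the first two apexes form a kite with the corner whose color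
    is that of the edge between them. *)
Lemma two_pure_bistar c r k : sym_col c -> pure c r ->
  (forall x, x != v0 -> vadj v1 x -> edge_in c (~~ r) v1 x) -> has_mono c (bistar k).
Proof.
move=> c_sym c_pure pure1.
have cof0 : cofinite c v0 r by exists [::] => x v0x _; exact: c_pure.
have cof1 : cofinite c v1 (~~ r).
  by exists [:: v0] => x v1x; rewrite inE => x0; exact: pure1.
apply: NNPP => noB.
have deg0 w : vadj v0 w -> infdeg c w (~~ r).
  move=> v0w; apply: NNPP => /not_infdeg; rewrite negbK => cof_w.
  exact: noB (cofinite_pair_bistar k c_sym v0w cof0 cof_w).
have deg1 w : vadj v1 w -> infdeg c w r.
  move=> v1w; apply: NNPP => /not_infdeg cof_w.
  exact: noB (cofinite_pair_bistar k c_sym v1w cof1 cof_w).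
have d0 := cofinite_infdeg cof0; have d1 := cofinite_infdeg cof1.
pose p := apex 0; pose q := apex 1.
have [dp dp' dq dq'] : [/\ infdeg c p r, infdeg c p (~~ r), infdeg c q r & infdeg c q (~~ r)].
  by split; [exact: deg1|exact: deg0|exact: deg1|exact: deg0].
apply: noB; have [pq|npq] := boolP (edge_in c r p q).
  apply: (@kite_bistar c r v0 v1 p q (inr [:: o1])) => //;
    by [exact: c_pure|exact: pure1].
have pq : edge_in c (~~ r) p q by exact: edge_inN.
apply: (@kite_bistar c (~~ r) v1 v0 p q (inr [:: o0])) => //; rewrite ?negbK //;
  by [exact: c_pure|exact: pure1].
Qed.

(** A neighbor of [v0] with finite degree in color [r] is moved to [v1], and [tail] then makes it
    pure up to the edge [v0 v1]. If there is none, an [r]-colored 4-cycle at [v0] has two neighbors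
    of [v0] as opposite vertices; without such a cycle, [petal_in_link] supplies one in the other
    color. *)
Lemma pure_bistar c r k : sym_col c -> pure c r -> has_mono c (bistar k).
Proof.
move=> c_sym c_pure.
have [[f [v0f nf]]|Hf] := classic (exists f, vadj v0 f /\ ~ infdeg c f r).
  have [e [He e0 e1]] := chart_edge v0f.
  apply: (has_mono_pull He); have c1_sym := sym_pull e c_sym.
  have c1_pure := pure_pull He e0 c_pure.
  have [|S HS] := @not_infdeg (pull c e) v1 r.
    by move=> d1; apply: nf; rewrite -e1; exact: infdeg_pull.
  pose j := (max_ht S).+1; have Ht := chart_tail j.
  apply: (has_mono_pull Ht); apply: (@two_pure_bistar _ r); first exact: sym_pull.
    exact: pure_pull Ht (tail_v0 j) c1_pure.
  move=> x x0 v1x; have x1 := vadj_neq v1x; rewrite eq_sym in x1.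
  have := HS (iter j tail x); rewrite -{1}(tail_v1 j) => /(_ (proj2 Ht _ _ v1x)).
  move/(_ (tail_notin (ltnSn _) x0 x1)).
  by rewrite /edge_in v1x /pull tail_v1 => /andP[].
have deg f : vadj v0 f -> infdeg c f r.
  by move=> v0f; apply: NNPP => nf; apply: Hf; exists f.
have [[a [y [b C]]]|noC] := classic (exists a y b, C4_in c r v0 a y b).
  have [_ v0a _ _ v0b] := and5P C; rewrite edge_in_sym // in v0b.
  apply: (@bistar_mono c r a y b v0) => //; first exact: C4_in_rot.
    by apply: deg; exact: edge_in_vadj v0a.
  by apply: deg; exact: edge_in_vadj v0b.
have {}noC : no_C4_v0 c r by move=> a y b; apply/negP => C; apply: noC; exists a, y, b.
have [a [y [b [C _ /and3P[_ v0y _]]]]] := petal_in_link [::] c_sym c_pure noC.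
by apply: bistar_mono C _ _ => //; apply: (link_infdeg c_sym c_pure noC).
Qed.

(** * Colorings with both colors at every vertex inside every triangle *)

Section Mixed.
Variable c : coloring.
Hypotheses (c_sym : sym_col c)
  (c_mixed : forall e r, chart e -> ~ pure (pull c e) r).

(** Zooming at [u] beyond [S] gives a triangle at [u] in which not all edges at [u] have color
    [~~ r]. *)
Lemma mixed_infdeg u r : infdeg c u r.
Proof.
move=> S; have [w uw] := ex_nbr u; have [e [He <- _]] := chart_edge uw.
have [S' HS'] := finite_preimage S (proj1 He); pose j := (max_ht S').+1.
have Hz := chart_zoom j.
have [x Hx] := not_all_ex_not _ _ (@c_mixed _ (~~ r) (chart_comp He Hz)).
have [v0x nx] := imply_to_and _ _ Hx.
exists (e (iter j zoom x)).
  have x0 := vadj_neq v0x; rewrite eq_sym in x0.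
  by apply: contra (zoom_notin (ltnSn (max_ht S')) x0) => /HS'.
have := edge_inN v0x (introN idP nx); rewrite negbK => /(edge_in_pull (chart_comp He Hz)).
by rewrite /= zoom_v0.
Qed.

Lemma mixed_bistar k : has_mono c (bistar k).
Proof.
have [r [a [y [b [C|C]]]]] := C4_through_corner c_sym;
  by apply: bistar_mono C _ _ => //; exact: mixed_infdeg.
Qed.

End Mixed.

(** If finite sets blocked both colors at [v1], shift by [tail] beyond their union. The 4-cycle
    through a corner that exists there meets [v1] and misses [v0], so all its other vertices avoid
    both sets. *)
Lemma infpet_corner c : sym_col c -> (forall r, no_C4_v0 c r) ->
  exists r, infpet c v1 r.
Proof.
move=> c_sym noC; apply: NNPP => no_r.
have ex_S r : exists S : seq V, ~ exists a y b, C4_in c r v1 a y b /\ ~~ has (mem S) [:: a; y; b].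
  apply: NNPP => noS; apply: no_r; exists r => S.
  by apply: NNPP => HS; apply: noS; exists S.
have [S1 HS1] := ex_S true; have [S2 HS2] := ex_S false.
pose j := (max_ht (S1 ++ S2)).+1; have Ht := chart_tail j.
have [r [a [y [b C]]]] := C4_through_corner (sym_pull (iter j tail) c_sym).
have {}C : C4_in (pull c (iter j tail)) r v1 a y b.
  case: C => // /(C4_in_pull Ht); rewrite tail_v0 => C.
  by have := noC r (iter j tail a) (iter j tail y) (iter j tail b); rewrite C.
have noC' := no_C4_v0_pull Ht (tail_v0 j) (noC r).
have ok z : z \in [:: a; y; b] -> iter j tail z \notin S1 ++ S2.
  move=> z_in; apply: tail_notin => //; last first.
    case/and5P: C => /andP[v1_in _] _ _ _ _.
    by apply: contraNneq v1_in => <-.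
  (* If [v0] were on the cycle, a rotation would make it the first vertex, contrary to [noC']. *)
  apply: contraTneq z_in => -> {z}; have C1 := C4_in_rot C; have C2 := C4_in_rot C1.
  have C3 := C4_in_rot C2; rewrite !inE !negb_or.
  apply/and3P; split; apply/eqP => E; subst.
  - exact: (negP (noC' _ _ _)) C1.
  - exact: (negP (noC' _ _ _)) C2.
  - exact: (negP (noC' _ _ _)) C3.
have := C4_in_pull Ht C; rewrite tail_v1 => C'.
have dS : ~~ has (mem (S1 ++ S2)) (map (iter j tail) [:: a; y; b]).
  by apply/hasPn => _ /mapP[z /ok z_ok ->].
have {}dS : ~~ has (mem S1) (map (iter j tail) [:: a; y; b]) /\
    ~~ has (mem S2) (map (iter j tail) [:: a; y; b]).
  by split; apply: contra dS => /hasP[z z1 z2]; apply/hasP; exists z => //;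
    move: z2; rewrite /= mem_cat => ->; rewrite ?orbT.
by case: r {noC'} C C' => C C'; [apply: HS1|apply: HS2]; do 3!eexists;
  split; by [exact: C'|case: dS].
Qed.

Lemma mixed_jellyfish c k : sym_col c ->
  (forall e r, chart e -> ~ pure (pull c e) r) -> has_mono c (jellyfish k).
Proof.
move=> c_sym c_mixed.
have jelly c' u r : sym_col c' -> (forall e r, chart e -> ~ pure (pull c' e) r) ->
    infpet c' u r -> has_mono c' (jellyfish k).
  move=> c'_sym c'_mixed pet; apply: (jellyfish_mono k c'_sym pet) => S.
  have [a aS ua] := mixed_infdeg c'_mixed u r S.
  by exists a; split=> //; exact: mixed_infdeg.
have [[r pet]|no_pet] := classic (exists r, infpet c v0 r).
  exact: jelly pet.
have [|j1 noC1] := @not_infpet_v0 c true; first by move=> pet; apply: no_pet; exists true.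
have [pet|j2 noC2] := @not_infpet_v0 (pull c (iter j1 zoom)) false.
  apply: no_pet; exists false; rewrite -(zoom_v0 j1).
  exact: infpet_pull (chart_zoom _) pet.
(* The first zoom removes the 4-cycles of color [true] at [v0], the second those of color
   [false]. *)
pose e := iter j1 zoom \o iter j2 zoom.
have He : chart e by apply: chart_comp; exact: chart_zoom.
apply: (has_mono_pull He).
have noC r : no_C4_v0 (pull c e) r.
  case: r; last exact: noC2.
  by apply: (no_C4_v0_pull (chart_zoom j2)) noC1; exact: zoom_v0.
have [r pet] := infpet_corner (sym_pull e c_sym) noC.
apply: jelly pet; first exact: sym_pull.
by move=> e' r' He'; exact: c_mixed (chart_comp He He').
Qed.

Lemma exists_arrows H :
  (forall c r, sym_col c -> pure c r -> has_mono c H) ->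
  (forall c, sym_col c -> (forall e r, chart e -> ~ pure (pull c e) r) -> has_mono c H) ->
  exists n, arrows (Tr n) H.
Proof.
move=> Hpure Hmixed; apply: compactness => c c_sym.
have [[e [r [He pure_e]]]|mixed] :=
    classic (exists e r, chart e /\ pure (pull c e) r).
  by apply: (has_mono_pull He); apply: Hpure pure_e; exact: sym_pull.
by apply: Hmixed => // e r He pure_e; apply: mixed; exists e, r.
Qed.

Lemma arrows_jellyfish k : exists n, arrows (Tr n) (jellyfish k).
Proof.
apply: exists_arrows => [c r|c]; [exact: pure_jellyfish|exact: mixed_jellyfish].
Qed.

Lemma arrows_bistar k : exists n, arrows (Tr n) (bistar k).
Proof.
apply: exists_arrows => [c r|c c_sym c_mixed]; first exact: pure_bistar.
exact: mixed_bistar.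
Qed.

(** * Colorings without odd cycles, K_{2,3} or adjacent pendant edges *)

Definition pair_coloring (G : sgraph) (col : rel G) (S : {set G}) : bool :=
  [exists x, [exists y, (S == [set x; y]) && col x y]].

Lemma pair_coloringE (G : sgraph) (col : rel G) x y : symmetric col ->
  pair_coloring col [set x; y] = col x y.
Proof.
move=> col_sym; apply/existsP/idP => [[a /existsP[b /andP[/eqP E ab]]]|xy]; last first.
  by exists x; apply/existsP; exists y; rewrite eqxx.
have xin : x \in [set a; b] by rewrite -E !inE eqxx.
have yin : y \in [set a; b] by rewrite -E !inE eqxx orbT.
have ain : a \in [set x; y] by rewrite E !inE eqxx.
have bin : b \in [set x; y] by rewrite E !inE eqxx orbT.
case/set2P: xin => Ex; case/set2P: yin => Ey; rewrite Ex Ey //; last 2 first.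
- by rewrite col_sym.
- by move: ain; rewrite Ex Ey => /set2P[] Ea; rewrite -{1}Ea.
- by move: bin; rewrite Ex Ey => /set2P[] Eb; rewrite -{2}Eb.
Qed.

Lemma arrows_col (G H : sgraph) (col : rel G) : arrows G H -> symmetric col ->
  exists (f : H -> G) (r : bool), is_copy f /\ (forall u v, adj u v -> col (f u) (f v) = r).
Proof.
move=> GH col_sym; have [f [r [Hf Hr]]] := GH (pair_coloring col).
by exists f, r; split=> // u v /Hr; rewrite pair_coloringE.
Qed.

Definition triangular (P : face_graph) : Prop :=
  forall (f : face P) i j, i != j -> adj (boundary f i) (boundary f j).

Lemma triangular_Tr n : triangular (Tr n).
Proof.
elim: n => [|n IHn]; first by move=> [] i j.
move=> [f k] i j ij /=; case: eqP => [ik|_]; case: eqP => [jk|_].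
- by rewrite ik jk eqxx in ij.
- by apply/existsP; exists j.
- by apply/existsP; exists i.
- exact: IHn.
Qed.

Lemma boundary_inj P (f : face P) : triangular P -> injective (boundary f).
Proof.
move=> tri i j Eij; apply/eqP; apply: contraT => /(tri f).
by rewrite Eij adj_irr.
Qed.

Lemma stack_adjP P (f : face P) (x : stack P) : adj (inr f : stack P) x ->
  exists i, x = inl (boundary f i).
Proof. by case: x => [u|g] //= /existsP[i /eqP <-]; exists i. Qed.

Definition missing_color (a b c : bool * bool) : bool * bool :=
  head (true, true) [seq z <- [:: (true, true); (true, false); (false, true); (false, false)]
                    | z \notin [:: a; b; c]].

Lemma missing_colorP a b c : missing_color a b c \notin [:: a; b; c].
Proof. by case: a b c => [[] []] [[] []] [[] []]. Qed.

Lemma Tr_four_coloring n :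
  exists kappa : Tr n -> bool * bool, forall u v, adj u v -> kappa u != kappa v.
Proof.
elim: n => [|n [kappa proper]].
  exists (fun i : 'I_3 => (val i == 0, val i == 1)).
  by apply: ord3P; apply: ord3P.
pose kf (f : face (Tr n)) := missing_color (kappa (boundary f o0))
  (kappa (boundary f o1)) (kappa (boundary f o2)).
have kfP f i : kappa (boundary f i) != kf f.
  have := missing_colorP (kappa (boundary f o0)) (kappa (boundary f o1))
    (kappa (boundary f o2)).
  rewrite -/(kf f) !inE !negb_or => /and3P[H0 H1 H2].
  by move: i; apply: ord3P; rewrite eq_sym.
exists (fun x : stack (Tr n) => match x with inl u => kappa u | inr f => kf f end).
case=> [u|f] [v|g] //=; first exact: proper.
  by case/existsP=> i /eqP <-.
by case/existsP=> i /eqP <-; rewrite eq_sym.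
Qed.

(** Color an edge by whether the first bits of a proper 4-coloring differ. One color class is
    bipartite by the first bit, the other by the second. *)
Lemma arrows_bipartite n (L : sgraph) : arrows (Tr n) L ->
  exists k : L -> bool, forall u v, adj u v -> k u != k v.
Proof.
move=> TL; have [kappa proper] := Tr_four_coloring n.
have [|f [r [[_ adj_f] Hr]]] := @arrows_col _ _ (fun u v => (kappa u).1 != (kappa v).1) TL.
  by move=> u v; rewrite eq_sym.
case: r Hr => Hr; first by exists (fun u => (kappa (f u)).1) => u v /Hr.
exists (fun u => (kappa (f u)).2) => u v uv.
have /eqP E1 := negbFE (Hr _ _ uv); apply: contraNneq (proper _ _ (adj_f _ _ uv)) => E2.
by rewrite [kappa (f u)]surjective_pairing E1 E2 -surjective_pairing.
Qed.

(* Every later edge at a vertex [u] gets the color [phi u]. In color [r] the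
   class [phi = r] then spans a forest, and a vertex outside this class is only
   joined to the two ends of an edge of this forest. *)
Record forest_coloring (P : face_graph) (phi : P -> bool) (col : rel P) : Prop := {
  fc_sym : symmetric col;
  fc_same : forall u v, adj u v -> phi u = phi v -> col u v = phi u;
  fc_deg : forall w y1 y2 y3, uniq [:: y1; y2; y3] ->
    (forall y, y \in [:: y1; y2; y3] -> adj w y /\ col w y = ~~ phi w) -> False;
  fc_adj : forall w y1 y2, y1 != y2 ->
    (forall y, y \in [:: y1; y2] -> adj w y /\ col w y = ~~ phi w) -> adj y1 y2;
  fc_C3 : forall u v w, adj u v -> adj v w -> adj w u ->
    phi u = phi v -> phi v = phi w -> False;
  fc_C4 : forall u v w x, u != w -> v != x -> adj u v -> adj v w -> adj w x -> adj x u ->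
    phi u = phi v -> phi v = phi w -> phi w = phi x -> False;
  fc_face : forall f : face P, exists i j, phi (boundary f i) != phi (boundary f j)
}.

Lemma minority (a : 'I_3 -> bool) : (exists i j, a i != a j) ->
  exists i, forall j, j != i -> a j = ~~ a i.
Proof.
case=> i [j ij].
case E0: (a o0); case E1: (a o1); case E2: (a o2);
  try by [exists o0; apply: ord3P; rewrite ?E0 ?E1 ?E2
         |exists o1; apply: ord3P; rewrite ?E0 ?E1 ?E2
         |exists o2; apply: ord3P; rewrite ?E0 ?E1 ?E2].
all: by move: i j ij; apply: ord3P; apply: ord3P; rewrite ?E0 ?E1 ?E2.
Qed.

Lemma ord3_third (i j : 'I_3) : exists k, (k != i) && (k != j).
Proof.
move: i j; apply: ord3P; apply: ord3P;
  by [exists o0|exists o1|exists o2].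
Qed.

Lemma ord3_pigeon (m i j k : 'I_3) : uniq [:: i; j; k] -> m \in [:: i; j; k].
Proof. by move: m i j k; do 4!apply: ord3P. Qed.

(** A new centre joins the class of the minority corner of its face. It thereby hangs as a leaf on
    this corner, and its other two neighbors are adjacent. *)
Lemma forest_coloring_Tr n : exists phi col, @forest_coloring (Tr n) phi col.
Proof.
elim: n => [|n [phi [col [c_sym same deg cadj C3 C4' face]]]].
  exists (fun i : 'I_3 => val i == 0), (fun _ _ => false); split=> //.
  - by apply: ord3P; apply: ord3P.
  - move=> w y1 y2 y3 u3 Hy; have := ord3_pigeon w u3 => /Hy[].
    by rewrite adj_irr.
  - by apply: ord3P; apply: ord3P; apply: ord3P.
  - by apply: ord3P; apply: ord3P; apply: ord3P.
  - by case; exists o0, o1.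
have tri := triangular_Tr (n := n).
have ex_mi f : exists i, [forall j, (j != i) ==> (phi (boundary f j) == ~~ phi (boundary f i))].
  have [i Hi] := minority (face f); exists i.
  by apply/forallP => j; apply/implyP => /Hi ->.
pose mi f := xchoose (ex_mi f).
have miP f j : j != mi f -> phi (boundary f j) = ~~ phi (boundary f (mi f)).
  by move=> jm; have /forallP/(_ j)/implyP/(_ jm)/eqP := xchooseP (ex_mi f).
pose psi (x : stack (Tr n)) := match x with inl u => phi u | inr f => phi (boundary f (mi f)) end.
pose dol (x y : stack (Tr n)) := match x, y with
  | inl u, inl v => col u v
  | inl u, inr _ => phi u
  | inr _, inl u => phi u
  | inr _, inr _ => false
  end.
have d_sym : symmetric dol by case=> [u|f] [v|g] //=.
have nbr_in f x : adj (inr f : stack (Tr n)) x -> psi x = psi (inr f) ->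
    x = inl (boundary f (mi f)).
  move=> /stack_adjP[i ->] /=; case: (eqVneq i (mi f)) => [-> //|/miP ->].
  by case: (phi _).
have twin f x y : adj (inr f : stack (Tr n)) x -> adj (inr f : stack (Tr n)) y ->
    psi x = psi (inr f) -> psi y = psi (inr f) -> x = y.
  by move=> fx fy /(nbr_in _ _ fx) -> /(nbr_in _ _ fy) ->.
have nbr_out f x : adj (inr f : stack (Tr n)) x -> dol (inr f) x = ~~ psi (inr f) ->
    exists2 i, x = inl (boundary f i) & i != mi f.
  move=> /stack_adjP[i ->] /= E; exists i => //.
  by apply: contra_eqN E => /eqP ->; case: (phi _).
(* New edges at an old vertex [u] have color [phi u], so its neighbors in the opposite color are all
   old. *)
have old u x : adj (inl u : stack (Tr n)) x -> dol (inl u) x = ~~ psi (inl u) ->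
    exists2 v, x = inl v & adj u v /\ col u v = ~~ phi u.
  by case: x => [v|f] /=; [exists v|case: (phi u)].
exists psi, dol; split=> //.
- by case=> [u|f] [v|g] //= uv; exact: same.
- case=> [u|f] y1 y2 y3 u3 Hy.
  + have [v1 E1 _] := old _ _ (proj1 (Hy y1 (mem_head _ _))) (proj2 (Hy y1 (mem_head _ _))).
    have [||v2 E2 _] := @old u y2; try by apply Hy; rewrite !inE eqxx ?orbT.
    have [||v3 E3 _] := @old u y3; try by apply Hy; rewrite !inE eqxx ?orbT.
    subst; apply: (deg u v1 v2 v3); first by move: u3; rewrite /= !inE.
    move=> y y_in; have [] := Hy (inl y) _; last by [].
    by move: y_in; rewrite !inE.
  + have [||i1 E1 n1] := @nbr_out f y1; try by apply Hy; rewrite !inE eqxx ?orbT.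
    have [||i2 E2 n2] := @nbr_out f y2; try by apply Hy; rewrite !inE eqxx ?orbT.
    have [||i3 E3 n3] := @nbr_out f y3; try by apply Hy; rewrite !inE eqxx ?orbT.
    have u3' : uniq [seq (inl (boundary f i) : stack (Tr n)) | i <- [:: i1; i2; i3]].
      by rewrite /= -E1 -E2 -E3.
    have := ord3_pigeon (mi f) (map_uniq u3'); rewrite !inE ![mi f == _]eq_sym.
    by rewrite (negPf n1) (negPf n2) (negPf n3).
- case=> [u|f] y1 y2 n12 Hy.
  + have [||v1 E1 H1] := @old u y1; try by apply Hy; rewrite !inE eqxx ?orbT.
    have [||v2 E2 H2] := @old u y2; try by apply Hy; rewrite !inE eqxx ?orbT.
    rewrite E1 E2 /=; apply: (cadj u) => [|y].
      by apply: contraNneq n12 => E; rewrite E1 E2 E.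
    by rewrite !inE => /orP[] /eqP ->.
  + have [||i1 E1 n1] := @nbr_out f y1; try by apply Hy; rewrite !inE eqxx ?orbT.
    have [||i2 E2 n2] := @nbr_out f y2; try by apply Hy; rewrite !inE eqxx ?orbT.
    rewrite E1 E2; apply: tri; apply: contraNneq n12 => E.
    by rewrite E1 E2 E.
- move=> u v w uv vw wu Euv Evw.
  have irr x y : adj x y -> x <> y :> stack (Tr n) by move=> xy E; rewrite E adj_irr in xy.
  case: u v w uv vw wu Euv Evw => [u|f] [v|g] [w|h] // uv vw wu Euv Evw;
    try exact: C3 uv vw wu Euv Evw.
  + by apply: (irr _ _ uv); apply: (twin h); rewrite ?Euv ?Evw // adj_sym.
  + by apply: (irr _ _ wu); apply: (twin g); rewrite ?Euv ?Evw // adj_sym.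
  + by apply: (irr _ _ vw); apply: (twin f); rewrite ?Euv ?Evw // adj_sym.
- move=> u v w x uw vx uv vw wx xu Euv Evw Ewx.
  case: u v w x uw vx uv vw wx xu Euv Evw Ewx =>
    [u|f] v w x uw vx uv vw wx xu Euv Evw Ewx; last first.
    by apply: (negP vx); apply/eqP; apply: (twin f); rewrite ?Euv ?Evw ?Ewx // adj_sym.
  case: w uw vw wx Evw Ewx => [w|f] uw vw wx Evw Ewx; last first.
    by apply: (negP vx); apply/eqP; apply: (twin f); rewrite ?Euv ?Evw ?Ewx // adj_sym.
  case: v vx uv vw Euv Evw => [v|f] vx uv vw Euv Evw; last first.
    by apply: (negP uw); apply/eqP; apply: (twin f); rewrite ?Euv ?Evw ?Ewx // adj_sym.
  case: x vx wx xu Ewx => [x|f] vx wx xu Ewx; last first.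
    by apply: (negP uw); apply/eqP; apply: (twin f); rewrite ?Euv ?Evw ?Ewx // adj_sym.
  exact: C4' uv vw wx xu Euv Evw Ewx.
(* The new face keeps the centre and a corner [j] outside the minority, which lie in different
   classes. *)
- case=> f i; have [j /andP[ji jm]] := ord3_third i (mi f).
  by exists i, j; rewrite /= eqxx (negPf ji) /= (miP _ _ jm); case: (phi _).
Qed.

(** The vertices [x] and [a] have degree three, hence lie in the class of the color [r]. If [w] or
    [b] is outside this class, its two neighbors on the cycle are adjacent and give a triangle
    inside the class; otherwise the 4-cycle lies inside it. Both contradict the forest property. *)
Lemma arrows_no_H1 n (L : sgraph) (x a w b c p : L) : arrows (Tr n) L ->
  uniq [:: x; a; w; b; c; p] -> adj x a -> adj a w -> adj w b -> adj b x ->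
  adj x c -> adj a p -> False.
Proof.
move=> TL u6 xa aw wb bx xc ap.
have [phi [col [c_sym same deg cadj C3 C4' _]]] := forest_coloring_Tr n.
have [f [r [[inj_f adj_f] Hr]]] := arrows_col TL c_sym.
have e u v : adj u v -> adj (f u) (f v) /\ col (f u) (f v) = r.
  by move=> uv; split; [exact: adj_f|exact: Hr].
have e' u v : adj v u -> adj (f u) (f v) /\ col (f u) (f v) = r.
  by rewrite adj_sym; exact: e.
have neg u : phi (f u) != r -> r = ~~ phi (f u) by case: (phi _) (r) => [] [].
have deg3 u y1 y2 y3 : uniq [:: y1; y2; y3] -> adj u y1 -> adj u y2 -> adj u y3 ->
    phi (f u) = r.
  move=> u3 h1 h2 h3; apply/eqP; apply: contraT => /neg Er.
  case: (deg (f u) (f y1) (f y2) (f y3)) => [|y].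
    by rewrite -[uniq _](map_inj_uniq inj_f) in u3.
  by rewrite -Er !inE => /or3P[] /eqP ->; exact: e.
have edge u v : adj u v -> phi (f u) != r -> phi (f v) = r.
  move=> uv nu; apply/eqP; apply: contraT => nv.
  have Euv : phi (f u) = phi (f v) by move: nu nv; case: (phi _) (phi _) (r) => [] [] [].
  by have [fuv] := e _ _ uv; rewrite (same _ _ fuv Euv) => E; rewrite E eqxx in nu.
have fneq u v : u != v -> f u != f v by rewrite (inj_eq inj_f).
move: (u6); rewrite /= !inE !negb_or -!andbA.
case/and5P=> nxa nxw nxb nxc /and5P[nxp naw nab nac /and5P[nap nwb nwc nwp]].
case/and4P=> nbc nbp ncp _.
have Ex : phi (f x) = r.
  apply: (deg3 _ a b c) => //; last by rewrite adj_sym.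
  by rewrite /= !inE negb_or nab nac nbc.
have Ea : phi (f a) = r.
  apply: (deg3 _ x w p) => //; last by rewrite adj_sym.
  by rewrite /= !inE negb_or nxw nxp nwp.
have [Ew|nw] := eqVneq (phi (f w)) r; last first.
  have Eb := edge _ _ wb nw; apply: (C3 (f x) (f a) (f b)); try congruence.
  - exact: adj_f.
  - apply: (cadj (f w)) => [|y]; first exact: fneq.
    by rewrite -(neg _ nw) !inE => /orP[] /eqP ->; [exact: e'|exact: e].
  - exact: adj_f.
have [Eb|nb] := eqVneq (phi (f b)) r; last first.
  apply: (C3 (f x) (f a) (f w)); try congruence; try exact: adj_f.
  rewrite adj_sym; apply: (cadj (f b)) => [|y]; first exact: fneq.
  by rewrite -(neg _ nb) !inE => /orP[] /eqP ->; [exact: e|exact: e'].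
apply: (C4' (f x) (f a) (f w) (f b)); try congruence; try exact: adj_f; exact: fneq.
Qed.

(** * A coloring without monochromatic K_{2,3} *)

Definition common_nbrs (G : sgraph) (col : rel G) (r : bool) (a b : G) : {set G} :=
  [set y | [&& adj a y, adj b y, col a y == r & col b y == r]].

Lemma common_nbrsC (G : sgraph) (col : rel G) r a b :
  common_nbrs col r a b = common_nbrs col r b a.
Proof. by apply/setP => y; rewrite !inE andbCA; do 2!congr (_ && _); exact: andbC. Qed.

(* Each face reserves one of its edges, [e1 f] - [e2 f], and its centre is joined
   in the color of this edge to exactly the two ends of this edge. *)
Record reserved_coloring (P : face_graph) (col : rel P) (e1 e2 : face P -> 'I_3) : Prop := {
  rc_sym : symmetric col;
  rc_neq : forall f, e1 f != e2 f;
  rc_inj : forall f g, [set boundary f (e1 f); boundary f (e2 f)] =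
    [set boundary g (e1 g); boundary g (e2 g)] -> f = g;
  rc_card : forall r a b, a != b -> #|common_nbrs col r a b| <= 2;
  rc_face : forall f, let a := boundary f (e1 f) in let b := boundary f (e2 f) in
    #|common_nbrs col (col a b) a b| <= 1
}.

(** Two old vertices gain a common neighbor in color [r] only if they span a reserved edge of color
    [r]. This happens through one face only, and such a pair had at most one before. A new centre
    has at most two neighbors in each color, so pairs containing it are harmless. *)
Lemma reserved_coloring_Tr n : exists col e1 e2, @reserved_coloring (Tr n) col e1 e2.
Proof.
elim: n => [|n [col [e1 [e2 [c_sym e_neq e_inj card2 card1]]]]].
  pose col : rel triangle := fun _ _ => true.
  have le1 r a b : a != b -> #|common_nbrs col r a b| <= 1.
    move=> ab; have /subset_leq_card : common_nbrs col r a b \subset ~: [set a; b].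
      apply/subsetP => y; rewrite !inE => /and4P[ay yb _ _].
      by apply/norP; split; apply/eqP => E; [move: ay|move: yb]; rewrite E adj_irr.
    by rewrite [X in _ <= X]cardsCs setCK cards2 ab card_ord.
  exists col, (fun _ => o0), (fun _ => o1); split=> //.
  - by move=> [] [].
  - by move=> r a b /(le1 r)/leq_trans; apply.
  - by move=> f; apply: le1.
have tri := triangular_Tr (n := n); have bd_inj f := boundary_inj (f := f) tri.
pose A f := boundary f (e1 f); pose B f := boundary f (e2 f).
have mem_AB f i : (boundary f i \in [set A f; B f]) = (i \in [set e1 f; e2 f]).
  by rewrite !inE !(inj_eq (bd_inj f)).
pose fcol f u := if u \in [set A f; B f] then col (A f) (B f) else ~~ col (A f) (B f).
pose dol (x y : stack (Tr n)) := match x, y with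
  | inl u, inl v => col u v
  | inl u, inr f => fcol f u
  | inr f, inl u => fcol f u
  | inr _, inr _ => false
  end.
have d_sym : symmetric dol by case=> [u|f] [v|g] //=.
pose nb r f := [set x : stack (Tr n) | adj (inr f : stack (Tr n)) x & dol (inr f) x == r].
have card_nb r f : #|nb r f| <= 2.
  pose J := if r == col (A f) (B f) then [set e1 f; e2 f] else ~: [set e1 f; e2 f].
  have le_J : #|J| <= 2.
    rewrite /J; have cJ := cards2 (e1 f) (e2 f); rewrite e_neq in cJ.
    case: ifP => _; first by rewrite cJ.
    by rewrite cardsCs setCK cJ card_ord.
  apply: leq_trans le_J; apply: leq_trans (leq_imset_card (fun i => inl (boundary f i)) _).
  apply: subset_leq_card; apply/subsetP => x; rewrite inE => /andP[/stack_adjP[i ->] /= Hr].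
  apply: imset_f; move: Hr; rewrite /fcol mem_AB /J.
  by case: (col _ _) (r) => [] []; case: ifP => // Hi _ /=; rewrite ?in_setC Hi.
(* The corner [fi.2] of the new face is the centre; the face reserves the edge from it to the
   cyclically next corner. *)
exists dol, (fun fi => fi.2), (fun fi => ordS fi.2).
have ordS_neq (i : 'I_3) : i != ordS i by move: i; apply: ord3P.
have sub_nb r f x : common_nbrs dol r (inr f : stack (Tr n)) x \subset nb r f.
  by apply/subsetP => y; rewrite !inE => /and4P[-> _ ->].
split=> //.
- move=> [f i] [g j] /=; rewrite !eqxx !ifN 1?eq_sym // => E.
  have : inr f \in [set (inr g : stack (Tr n)); inl (boundary g (ordS j))].
    by rewrite -E !inE eqxx.
  rewrite !inE orbF => /eqP [Efg]; subst g.
  have : inl (boundary f (ordS i)) \in [set (inr f : stack (Tr n)); inl (boundary f (ordS j))].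
    by rewrite -E !inE eqxx orbT.
  by rewrite !inE /= => /eqP [/bd_inj/ordS_inj ->].
- move=> r [a|f] b ab; last first.
    exact: leq_trans (subset_leq_card (sub_nb _ _ _)) (card_nb _ _).
  case: b ab => [b|f] ab; last first.
    rewrite common_nbrsC.
    exact: leq_trans (subset_leq_card (sub_nb _ _ _)) (card_nb _ _).
  have {}ab : a != b by apply: contraNneq ab => ->.
  (* [F] holds the faces whose centre becomes a new common neighbor; by [e_inj] there is at most
     one. *)
  pose F := [set f : face (Tr n) | (r == col a b) && ([set a; b] == [set A f; B f])].
  have sub : common_nbrs dol r (inl a : stack (Tr n)) (inl b)
      \subset [set inl y | y in common_nbrs col r a b] :|: [set inr f | f in F].
    apply/subsetP => -[y|f]; rewrite inE.
      move=> H; apply/setUP; left; apply: imset_f; by rewrite inE.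
    move=> /and4P[/existsP[i /eqP Ea] /existsP[j /eqP Eb] /= Ha Hb].
    apply/setUP; right; apply: imset_f; rewrite inE.
    have ij : i != j by apply: contraNneq ab => E; rewrite -Ea -Eb E.
    move: Ha Hb; rewrite -Ea -Eb /fcol !mem_AB.
    have [Hi|Hi] := boolP (i \in _); have [Hj|Hj] := boolP (j \in _);
      move=> /eqP Er /eqP Er'.
    - case/set2P: Hi ij => ->; case/set2P: Hj => -> ij; rewrite ?eqxx // -Er in ij *.
        by rewrite /A /B !eqxx.
      by rewrite c_sym setUC /A /B !eqxx.
    - by move: Er'; rewrite -Er; case: (col _ _).
    - by move: Er'; rewrite -Er; case: (col _ _).
    - move: Hi Hj; rewrite !inE !negb_or => /andP[i1 i2] /andP[j1 j2].
      have := @ord3_pigeon (e2 f) i j (e1 f); rewrite /= !inE negb_or ij i1 j1 !(eq_sym (e2 f)).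
      by rewrite (negPf i2) (negPf j2) (negPf (e_neq f)) => /(_ isT).
  apply: leq_trans (subset_leq_card sub) _; apply: leq_trans (leq_card_setU _ _) _.
  apply: leq_trans (leq_add (leq_imset_card _ _) (leq_imset_card _ _)) _.
  have [->|[f Hf]] := set_0Vmem F; first by rewrite cards0 addn0 card2.
  have -> : F = [set f].
    apply/setP => g; apply/idP/set1P => [Hg|-> //].
    move: Hf Hg; rewrite !inE => /andP[_ /eqP Ef] /andP[_ /eqP Eg].
    by apply: e_inj; rewrite -/(A _) -/(B _) -Eg -Ef.
  rewrite cards1 addn1 ltnS; move: Hf; rewrite inE => /andP[/eqP -> /eqP Ef].
  have : a \in [set A f; B f] by rewrite -Ef set21.
  have : b \in [set A f; B f] by rewrite -Ef set22.
  case/set2P=> Eb; case/set2P=> Ea; rewrite Ea Eb ?eqxx // in ab *.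
    by rewrite c_sym common_nbrsC; exact: card1.
  exact: card1.
- case=> f i /=; rewrite eqxx ifN 1?eq_sym //.
  set r := dol _ _; set b := inl _.
  have b_nb : b \in nb r f.
    by rewrite inE eqxx andbT; apply/existsP; exists (ordS i).
  have : common_nbrs dol r (inr f : stack (Tr n)) b \subset nb r f :\ b.
    apply/subsetP => y Hy; rewrite in_setD1 (subsetP (sub_nb _ _ _) _ Hy) andbT.
    by apply: contraTneq Hy => ->; rewrite inE adj_irr andbF.
  move/subset_leq_card/leq_trans; apply.
  by have := card_nb r f; rewrite (cardsD1 b) b_nb.
Qed.

Lemma arrows_no_K23 n (L : sgraph) (a b w1 w2 w3 : L) : arrows (Tr n) L ->
  a != b -> uniq [:: w1; w2; w3] ->
  (forall w, w \in [:: w1; w2; w3] -> adj a w && adj b w) -> False.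
Proof.
move=> TL ab u3 Hw; have [col [e1 [e2 [c_sym _ _ card2 _]]]] := reserved_coloring_Tr n.
have [f [r [[inj_f adj_f] Hr]]] := arrows_col TL c_sym.
have := card2 r (f a) (f b); rewrite (inj_eq inj_f) => /(_ ab); apply/negP; rewrite -ltnNge.
rewrite -(map_inj_uniq inj_f) in u3.
have <- : #|[set y in map f [:: w1; w2; w3]]| = 3 by rewrite cardsE (card_uniqP u3).
apply/subset_leq_card/subsetP => y; rewrite inE => /mapP[w /Hw/andP[aw bw] ->].
by rewrite inE !adj_f // !Hr // eqxx.
Qed.

(** * Graphs of radius two *)

Definition star_leaf k (i : 'I_k) : {z : star k | z != None} :=
  exist (fun z : star k => z != None) (Some i) isT.
Definition tree_child k (i : 'I_k) : {z : tree2 k | z != None} :=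
  exist (fun z : tree2 k => z != None) (Some (i, None)) isT.
Definition tree_leaf k (i j : 'I_k) : {z : tree2 k | z != None} :=
  exist (fun z : tree2 k => z != None) (Some (i, Some j)) isT.

Section RadiusTwo.
Variables (L : sgraph) (x : L) (kappa : L -> bool).
Hypotheses
  (bip : forall u v : L, adj u v -> kappa u != kappa v)
  (rad : forall y, [\/ y = x, adj x y | exists2 z, adj x z & adj z y])
  (noK23 : forall a b w1 w2 w3 : L, a != b -> uniq [:: w1; w2; w3] ->
     (forall w, w \in [:: w1; w2; w3] -> adj a w && adj b w) -> False)
  (noH1 : forall x a w b c p : L, uniq [:: x; a; w; b; c; p] ->
     adj x a -> adj a w -> adj w b -> adj b x -> adj x c -> adj a p -> False).

Lemma adj_neq (u v : L) : adj u v -> u != v.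
Proof. by apply: contraTneq => ->; rewrite adj_irr. Qed.

(** Every vertex is within distance two of [x], so parity of the distance decides the side of the
    bipartition. *)
Lemma adj_root y : adj x y = (kappa y != kappa x).
Proof.
apply/idP/idP => [/bip|]; first by rewrite eq_sym.
case: (rad y) => [->|//|[z /bip xz /bip zy]]; first by rewrite eqxx.
by move: xz zy; case: (kappa x) (kappa y) (kappa z) => [] [] [].
Qed.

Lemma adj_side u v : adj u v -> adj x u = ~~ adj x v.
Proof.
by move/bip; rewrite !adj_root; case: (kappa x) (kappa u) (kappa v) => [] [] [].
Qed.

(** A third neighbor [c] of [x] would give the forbidden 4-cycle with pendant edges [x c] and [a p].
    So [x] has only the neighbors [a] and [b], and every vertex off the cycle [a x b w] is adjacent
    to one of them, not to both by [noK23]: it is a leaf of the bistar with roots [a] and [b]. *)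
Lemma embed_bistar (a b w p : L) :
  adj x a -> adj x b -> a != b -> adj a w -> adj b w -> w != x ->
  adj a p -> p != x -> p != w -> subgraph_of L (bistar #|L|).
Proof.
move=> xa xb ab aw bw wx ap px pw.
have far u : adj a u -> ~~ adj x u by move/adj_side; rewrite xa => <-.
have nbr_x c : adj x c -> (c == a) || (c == b).
  move=> xc; apply: contraT; rewrite negb_or => /andP[ca cb].
  have xw := far _ aw; have xp := far _ ap.
  have near u v : adj x u -> ~~ adj x v -> u != v.
    by move=> xu; apply: contraNneq => <-.
  case: (noH1 (x := x) (a := a) (w := w) (b := b) (c := c) (p := p)) => //;
    try by rewrite adj_sym.
  rewrite /= !inE !negb_or ab (adj_neq xa) (adj_neq xb) (adj_neq xc) (adj_neq aw).
  rewrite (adj_neq ap) !(eq_sym x) wx px !(eq_sym w) pw (near b w) // (near c w) //.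
  by rewrite (near b p) // (near c p) // !(eq_sym _ c) ca cb.
have noab u : u != x -> u != w -> adj a u -> adj b u -> False.
  move=> ux uw au bu; apply: (noK23 (a := a) (b := b) (w1 := x) (w2 := w) (w3 := u)) => //.
    by rewrite /= !inE negb_or !(eq_sym x) wx ux eq_sym uw.
  by move=> z; rewrite !inE => /or3P[] /eqP ->; rewrite ?aw ?bw ?au ?bu // adj_sym xa adj_sym.
pose k := #|L|; pose g (y : L) : bistar k :=
  if y == a then inl (inl (inord 0)) else if y == x then inl (inl (inord 1)) else
  if y == b then inl (inl (inord 2)) else if y == w then inl (inl (inord 3)) else
  if adj a y then inl (inr (star_leaf (enum_rank y))) else inr (star_leaf (enum_rank y)).
have wa : (w == a) = false by rewrite eq_sym; apply: negbTE (adj_neq aw).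
have xa' : (x == a) = false by apply: negbTE (adj_neq xa).
have wb : (w == b) = false by rewrite eq_sym; apply: negbTE (adj_neq bw).
have bx : (b == x) = false by rewrite eq_sym; apply: negbTE (adj_neq xb).
have ga : g a = inl (inl (inord 0)) by rewrite /g eqxx.
have gx : g x = inl (inl (inord 1)) by rewrite /g xa' eqxx.
have gb : g b = inl (inl (inord 2)) by rewrite /g eq_sym (negPf ab) bx eqxx.
have gw : g w = inl (inl (inord 3)) by rewrite /g wa (negPf wx) wb eqxx.
have inordE i j : i < 4 -> j < 4 -> inord i = inord j :> 'I_4 -> i = j.
  by move=> lt_i lt_j /(congr1 val); rewrite /= !inordK.
exists g; split.
  move=> y z; rewrite /g.
  case: (eqVneq y a) => [->|_]; [|case: (eqVneq y x) => [->|_];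
    [|case: (eqVneq y b) => [->|_]; [|case: (eqVneq y w) => [->|_]; [|case: (adj a y)]]]];
  (case: (eqVneq z a) => [->|_]; [|case: (eqVneq z x) => [->|_];
    [|case: (eqVneq z b) => [->|_]; [|case: (eqVneq z w) => [->|_]; [|case: (adj a z)]]]])
  => //; try by [case=> /inordE; move/(_ isT isT)|case=> /enum_rank_inj].
have edge y z : adj y z -> adj x y -> adj (g y) (g z).
  move=> yz xy; have xz : ~~ adj x z by rewrite -(adj_side yz).
  have [Ez|zx] := eqVneq z x.
    rewrite Ez gx; case/orP: (nbr_x _ xy) => /eqP ->; rewrite ?ga ?gb /= /C4_adj !inordK //.
  have [Ez|zw] := eqVneq z w.
    rewrite Ez gw; case/orP: (nbr_x _ xy) => /eqP ->; rewrite ?ga ?gb /= /C4_adj !inordK //.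
  have za : (z == a) = false by apply: contraNF xz => /eqP ->.
  have zb : (z == b) = false by apply: contraNF xz => /eqP ->.
  case/orP: (nbr_x _ xy) => /eqP Ey; rewrite Ey in yz *.
    by rewrite ga /g za (negPf zx) zb (negPf zw) yz /= eqxx.
  have az : adj a z = false by apply/negP => az; apply: noab yz.
  by rewrite gb /g za (negPf zx) zb (negPf zw) az /= eqxx.
move=> y z yz; have [xy|xy] := boolP (adj x y); first exact: edge.
rewrite adj_sym; apply: edge; first by rewrite adj_sym.
by rewrite (adj_side yz) negbK in xy.
Qed.

Definition in_petal (a b w : L) : Prop :=
  [/\ adj x a, adj x b & a != b] /\ [/\ adj a w, adj b w & w != x].

(* A vertex [a] (or [w]) of a cycle [x a w b] goes to the petal indexed by [w];
   comparing [a] with [b] tells the two sides of the petal apart. *)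
Inductive jelly_pos : L -> jellyfish #|L| -> Prop :=
| JRoot : jelly_pos x (inl None)
| JTip a b w of in_petal a b w : jelly_pos w (inl (Some (enum_rank w, o1)))
| JSide a b w of in_petal a b w :
    jelly_pos a (inl (Some (enum_rank w, if enum_rank a < enum_rank b then o0 else o2)))
| JChild a of adj x a & (forall b w, ~ in_petal a b w) :
    jelly_pos a (inr (tree_child (enum_rank a)))
| JLeaf a y of adj x a & adj a y & y != x & (forall b, ~ in_petal a b y) :
    jelly_pos y (inr (tree_leaf (enum_rank a) (enum_rank y))).

Lemma in_petalC a b w : in_petal a b w -> in_petal b a w.
Proof. by case=> [[xa xb ab] [aw bw wx]]; do !split; rewrite // eq_sym. Qed.

(** A third such vertex would form a K_{2,3} with [x] and [w]; hence the tip determines its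
    petal. *)
Lemma in_petal_uniq a b c w : in_petal a b w -> adj x c -> adj c w -> (c == a) || (c == b).
Proof.
case=> [[xa xb ab] [aw bw wx]] xc cw; apply: contraT; rewrite negb_or => /andP[ca cb].
case: (noK23 (a := x) (b := w) (w1 := a) (w2 := b) (w3 := c)).
- by rewrite eq_sym.
- by rewrite /= !inE negb_or ab !(eq_sym _ c) ca cb.
- by move=> z; rewrite !inE => /or3P[] /eqP ->; rewrite adj_sym adj_sym ?xa ?xb ?xc adj_sym.
Qed.

(** This is the case left over by [embed_bistar]. *)
Hypothesis side_deg : forall a b w p, in_petal a b w -> adj a p -> p != x -> p = w.

Lemma jelly_pos_total y : exists z, jelly_pos y z.
Proof.
case: (rad y) => [->|xy|[a xa ay]]; first by exists (inl None); constructor.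
  have [[b [w Hp]]|no_p] := classic (exists b w, in_petal y b w).
    by eexists; exact: JSide Hp.
  by eexists; apply: JChild => // b w Hp; apply: no_p; exists b, w.
have [->|yx] := eqVneq y x; first by exists (inl None); constructor.
have [[b Hp]|no_p] := classic (exists b, in_petal a b y).
  by eexists; exact: JTip Hp.
by eexists; apply: JLeaf xa ay yx _ => b Hp; apply: no_p; exists b.
Qed.

Lemma jelly_pos_inj y y' z z' : jelly_pos y z -> jelly_pos y' z' -> z = z' -> y = y'.
Proof.
case=> [|a b w Hp|a b w Hp|a xa no|a u xa au ux no];
  case=> [|a' b' w' Hp'|a' b' w' Hp'|a' xa' no'|a' u' xa' au' ux' no'] //.
- by case=> /enum_rank_inj.
- by case: ifP => _ [] _.
- by case: ifP => _ [] _.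
- case=> /enum_rank_inj Ew; subst w' => E.
  have [[xa' _ ab'] [aw' _ _]] := Hp'; have [[xb' _ _] [bw' _ _]] := in_petalC Hp'.
  have [/eqP -> //|/eqP Eb] := orP (in_petal_uniq Hp xa' aw').
  have [/eqP Ea|/eqP Eb'] := orP (in_petal_uniq Hp xb' bw'); last first.
    by rewrite Eb Eb' eqxx in ab'.
  move: E; rewrite Eb Ea; case: ltngtP => // /ord_inj/enum_rank_inj Eab.
  by move: ab'; rewrite Eb Ea Eab eqxx.
- by case=> /enum_rank_inj.
- by case=> _ /enum_rank_inj.
Qed.

Lemma jelly_pos_adj y y' z z' : adj y y' -> adj x y -> jelly_pos y z -> jelly_pos y' z' ->
  adj z z'.
Proof.
move=> yy' xy Hz Hz'; have xy' : ~~ adj x y' by rewrite -(adj_side yy').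
have tip a u : adj x a -> adj a u -> ~~ adj x u by move=> xa /adj_side <-.
case: Hz' yy' xy' => [|a' b' w' Hp'|a' b' w' Hp'|a' xa' no'|a' u' xa' au' ux' no'] yy' xy';
  case: Hz yy' xy => [|a b w Hp|a b w Hp|a xa no|a u xa au ux no] yy' xy //;
  try by [rewrite adj_irr in xy
         |have [[xc _ _] [cw _ _]] := Hp; have := tip _ _ xc cw; rewrite xy
         |have := tip _ _ xa au; rewrite xy
         |have [[xc _ _] _] := Hp'; rewrite xc in xy'
         |rewrite xa' in xy'].
- by case: ifP.
- have [[_ _ _] [_ _ wx']] := Hp'.
  by rewrite (side_deg Hp yy' wx'); case: ifP => _ /=; rewrite eqxx.
- have := in_petal_uniq Hp' xy yy'; case/orP=> /eqP Ea; rewrite Ea in no.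
    by case: (no _ _ Hp').
  by case: (no _ _ (in_petalC Hp')).
- have Eu := side_deg Hp yy' ux'; rewrite -Eu in Hp.
  have := in_petal_uniq Hp xa' au'; case/orP=> /eqP Ea; rewrite Ea in no'.
    by case: (no' _ Hp).
  by case: (no' _ (in_petalC Hp)).
- suff -> : a = a' by rewrite /= eqxx.
  (* Two distinct neighbors [a] and [a'] of [x] below which [y'] hangs would form a petal with tip
     [y'], which [JLeaf] excludes. *)
  apply/eqP; apply: contraT => aa'; case: (no' a).
  by do !split; rewrite // eq_sym.
Qed.

Lemma embed_jellyfish : subgraph_of L (jellyfish #|L|).
Proof.
have [g gP] := choice _ jelly_pos_total.
exists g; split; first by move=> y z; exact: jelly_pos_inj (gP y) (gP z).
move=> y z yz; have [xy|xy] := boolP (adj x y).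
  exact: jelly_pos_adj yz xy (gP y) (gP z).
rewrite adj_sym; apply: jelly_pos_adj (gP z) (gP y); first by rewrite adj_sym.
by rewrite (adj_side yz) negbK in xy.
Qed.

End RadiusTwo.

Lemma arrows_subgraph (G H K : sgraph) : subgraph_of H K -> arrows G K -> arrows G H.
Proof.
move=> [g [inj_g adj_g]] GK c; have [f [r [[inj_f adj_f] Hr]]] := GK c.
exists (f \o g), r; split=> [|u v /adj_g/Hr //].
by split=> [|u v /adj_g/adj_f]; first exact: inj_comp.
Qed.

Theorem theorem1p2 (L : sgraph) (hL : is_radius L 2) :
  (exists n : nat, arrows (Tr n) L) <->
  (exists k : nat, 0 < k /\
     (subgraph_of L (jellyfish k) \/ subgraph_of L (bistar k))).
Proof.
split=> [[n TL]|[k [_ [LJ|LB]]]]; last 2 first.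
- have [n TJ] := arrows_jellyfish k; exists n; exact: arrows_subgraph LJ TJ.
- have [n TB] := arrows_bistar k; exists n; exact: arrows_subgraph LB TB.
have [[x [ecc _]] _] := hL.
have rad y : [\/ y = x, adj x y | exists2 z, adj x z & adj z y].
  have [d [[p [xp Ey sz_p]] _] le_d] := ecc y; rewrite -sz_p in le_d.
  case: p xp Ey le_d {sz_p} => [|z [|z' [|? ?]]] //=.
  - by constructor 1.
  - by rewrite andbT => xz <-; constructor 2.
  - by case/and3P=> xz zz' _ <-; constructor 3; exists z.
have [kappa bip] := arrows_bipartite TL.
have noK23 a b w1 w2 w3 := @arrows_no_K23 n L a b w1 w2 w3 TL.
have noH1 u a w b c p := @arrows_no_H1 n L u a w b c p TL.
exists #|L|; split; first by apply/card_gt0P; exists x.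
(* A petal side with a neighbor other than [x] and the tip leads to a bistar; if there is none, the
   petals meet the rest of the graph only at [x] and at their tips. *)
have [[a [b [w [p [Hp [ap px pw]]]]]]|no_p] :=
    classic (exists a b w p, in_petal x a b w /\ [/\ adj a p, p != x & p != w]).
  case: Hp => [[xa xb ab] [aw bw wx]]; right.
  exact: (@embed_bistar L x kappa bip rad noK23 noH1 a b w p).
left; apply: (@embed_jellyfish L x kappa bip rad noK23) => a b w p Hp ap px.
by apply/eqP; apply: contraT => pw; case: no_p; exists a, b, w, p.
Qed.
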